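(* Let $f\in W$ and, for each $n\ge 1$, let $u_n\in W$ be a solution of the Neumann problem $$ \begin{aligned} f(x) ={}& \chi_{A_n}(x)\int_{A_n} J(x,y)(u_n(y)-u_n(x))\,dy + \chi_{A_n}(x)\int_{B_n} R(x,y)(u_n(y)-u_n(x))\,dy\\ &+\chi_{B_n}(x)\int_{A_n} R(x,y)(u_n(y)-u_n(x))\,dy+\chi_{B_n}(x)\int_{B_n} G(x,y)(u_n(y)-u_n(x))\,dy,\qquad x\in\Omega . \end{aligned} $$ Assume that $\chi_{A_n}\to X$ weakly-* in $L^\infty(\Omega)$ as $n\to\infty$. Then there exists a unique pair $(u_A,u_B)\in L^2(\Omega)\times L^2(\Omega)$ with $\int_\Omega (u_A(x)+u_B(x))\,dx=0$ and $$\chi_{A_n}u_n\rightharpoonup u_A\quad\text{and}\quad \chi_{B_n}u_n\rightharpoonup u_B\quad\text{weakly in } L^2(\Omega)\text{ as } n\to\infty .$$ The pair $(u_A,u_B)$ is characterized as the unique solution, among pairs in $L^2(\Omega)\times L^2(\Omega)$ satisfying $\int_\Omega (u_A+u_B)\,dx=0$, of the system (for $x\in\Omega$) $$ X(x)f(x)=\int_\Omega J(x,y)\big[X(x)u_A(y)-X(y)u_A(x)\big]dy+\int_\Omega R(x,y)\big[X(x)u_B(y)-u_A(x)(1-X(y))\big]dy, $$ $$ (1-X(x))f(x)=\int_\Omega R(x,y)\big[u_A(y)(1-X(x))-u_B(x)X(y)\big]dy+\int_\Omega G(x,y)\big[u_B(y)(1-X(x))-u_B(x)(1-X(y))\big]dy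 . $$
   Context: $\Omega\subset\mathbb{R}^N$ is a bounded domain (open, connected). The kernels $V=J,G,R$ each satisfy: $V:\mathbb{R}^N\times\mathbb{R}^N\to\mathbb{R}$ is continuous and non-negative, $V(x,x)>0$ for every $x$, $V(x,y)=V(y,x)$ for all $x,y$, and $\int_{\mathbb{R}^N}V(x,y)\,dy=1$ for every $x$. For each $n\ge1$, $A_n,B_n$ are measurable sets with $\Omega=A_n\cup B_n$ and $A_n\cap B_n=\emptyset$; $\chi_E$ denotes the characteristic function of a set $E$. $X\in L^\infty(\Omega)$ is the weak-* limit of $\chi_{A_n}$ (so $\chi_{B_n}\to 1-X$ weakly-* in $L^\infty(\Omega)$). $W=\{u\in L^2(\Omega):\int_\Omega u\,dx=0\}$. Equations are understood for a.e. $x\in\Omega$. *)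

(* Defs.v *)
From HB Require Import structures.
From mathcomp Require Import all_boot all_order all_algebra.
From mathcomp Require Import all_classical all_reals all_analysis.

Set Implicit Arguments.
Unset Strict Implicit.
Unset Printing Implicit Defensive.

Import Order.TTheory GRing.Theory Num.Def Num.Theory.
Import numFieldNormedType.Exports.

Local Open Scope classical_set_scope.
Local Open Scope ring_scope.

Section lebesgue_outer_measure.
Local Open Scope ereal_scope.
Context (R : realType) (N : nat).
Notation vec := 'rV[R]_N.+1.

Definition box (a b : vec) : set vec :=
  [set x | forall i, (a ord0 i < x ord0 i <= b ord0 i)%R].

(* The truncation at 0 gives volume 0 to the empty boxes. *)
Definition box_volume (a b : vec) : R :=
  (\prod_(i < N.+1) maxr 0 (b ord0 i - a ord0 i))%R.

Definition box_cover (X : set vec) : set (nat -> vec * vec) :=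
  [set F | X `<=` \bigcup_k box (F k).1 (F k).2].

Definition lebesgue_outer (X : set vec) : \bar R :=
  ereal_inf [set \sum_(k <oo) (box_volume (F k).1 (F k).2)%:E
            | F in box_cover X].

Let vol (p : vec * vec) : \bar R := (box_volume p.1 p.2)%:E.

Let vol_ge0 p : 0 <= vol p.
Proof. by rewrite lee_fin; apply: prodr_ge0 => i _; rewrite le_max lexx. Qed.

Lemma le_lebesgue_outer :
  {homo lebesgue_outer : A B / A `<=` B >-> A <= B}.
Proof.
move=> A B AB; apply/ereal_inf_le_tmp => x [F BF <-{x}].
by exists F => //; exact: subset_trans AB BF.
Qed.

Lemma lebesgue_outer_ge0 A : 0 <= lebesgue_outer A.
Proof.
by apply: le_ereal_inf_tmp => x [F AF <-{x}]; apply: nneseries_ge0 => n _ _;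
   exact: vol_ge0.
Qed.

Lemma lebesgue_outer0 : lebesgue_outer set0 = 0.
Proof.
apply/eqP; rewrite eq_le lebesgue_outer_ge0 andbT.
apply: ereal_inf_lbound; exists (fun=> (0%R, 0%R)) => //=.
rewrite eseries0// => k _ _; rewrite /box_volume big_ord_recl/= subrr maxxx.
by rewrite mul0r.
Qed.

Lemma lebesgue_outer_sigma_subadditive : sigma_subadditive lebesgue_outer.
Proof.
move=> A; have [[i ioo]|] := pselect (exists i, lebesgue_outer (A i) = +oo).
  rewrite (eseries_pinfty _ _ ioo) ?leey// => n _.
  by rewrite -ltNye (lt_le_trans _ (lebesgue_outer_ge0 _)).
rewrite -forallNE => Aoo.
suff add2e (e : {posnum R}) : lebesgue_outer (\bigcup_n A n) <=
    \sum_(i <oo) lebesgue_outer (A i) + e%:num%:E.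
  by apply/lee_addgt0Pr => _/posnumP[].
rewrite (le_trans _ (epsilon_trick _ _ _))//; last first.
  by move=> n; exact: lebesgue_outer_ge0.
pose P n F := box_cover (A n) F /\
  \sum_(k <oo) vol (F k) <=
  lebesgue_outer (A n) + (e%:num / (2 ^ n.+1)%:R)%:E.
have [G PG] : {G : nat -> nat -> vec * vec & forall n, P n (G n)}.
  apply: (@choice _ _ P) => n; rewrite /P /lebesgue_outer.
  set S := (X in ereal_inf X); move infS : (ereal_inf S) => iS.
  case: iS infS => [r Sr|Soo|Soo].
  - have en1 : (0 < e%:num / (2 ^ n.+1)%:R)%R by [].
    have /(lb_ereal_inf_adherent en1) : ereal_inf S \is a fin_num by rewrite Sr.
    move=> [x [B AnB <-] xS].
    by exists B; split => //; rewrite -Sr; exact/ltW.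
  - by have := Aoo n; rewrite /lebesgue_outer Soo.
  - suff : lbound S 0 by move/le_ereal_inf_tmp; rewrite Soo.
    by move=> /= _ [B AnB <-]; apply: nneseries_ge0 => k _ _; exact: vol_ge0.
pose g := uncurry G.
have volG_ge0 x : 0 <= (vol \o g) x by exact: vol_ge0.
apply: (@le_trans _ _ (\esum_(i in setT) (vol \o g) i)).
  apply: ereal_inf_lbound => /=.
  have /card_esym/ppcard_eqP[f] := card_nat2.
  exists (g \o f).
    move=> t [i _ /(PG i).1 [j _ Gt]]; exists (f^-1%FUN (i, j)) => //=.
    by rewrite invK ?inE.
  rewrite -(esum_pred_image (vol \o g) _ xpredT) ?[fun=> _]set_true//.
  by rewrite image_eq.
rewrite (_ : esum _ _ = \sum_(i <oo) \sum_(j <oo) vol (G i j)); last first.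
  pose J : nat -> set (nat * nat) := fun i => [set (i, j) | j in setT].
  rewrite (_ : setT = \bigcup_k J k); last first.
    by rewrite predeqE => -[a b]; split => // _; exists a => //; exists b.
  rewrite esum_bigcupT /=; last 2 first.
    - apply/trivIsetP => i j _ _ ij.
      rewrite predeqE => -[n m] /=; split => //= -[] [_] _ [<-{n} _].
      by move=> [m' _] [] /esym/eqP; rewrite (negbTE ij).
    - by move=> /= p; exact: vol_ge0.
  rewrite -(image_id [set: nat]) -fun_true esum_pred_image//; last first.
    by move=> n _; apply: esum_ge0 => *; exact: vol_ge0.
  apply: eq_eseriesr => /= j _.
  rewrite -(esum_pred_image (vol \o g) (pair j) predT)//=; last first.
    by move=> ? ? _ _; exact: (@can_inj _ _ _ snd).
  by congr esum; rewrite predeqE => -[a b]; split; move=> [i _ <-]; exists i.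
apply: lee_lim.
- apply: is_cvg_nneseries => n *.
  by apply: nneseries_ge0 => m *; exact: (volG_ge0 (n, m)).
- apply: is_cvg_nneseries => n *.
  by apply: adde_ge0 => //; exact: lebesgue_outer_ge0.
- by near=> n; apply: lee_sum => i _; exact: (PG i).2.
Unshelve. all: by end_near. Qed.

HB.instance Definition _ := isOuterMeasure.Build R vec lebesgue_outer
  lebesgue_outer0 lebesgue_outer_ge0 le_lebesgue_outer
  lebesgue_outer_sigma_subadditive.

End lebesgue_outer_measure.

(* R^(N+1) with its usual topology and the sigma-algebra of all
   Lebesgue-measurable (and not only Borel) sets. *)
Definition Rn (R : realType) (N : nat) : Type := 'rV[R]_N.+1.

HB.instance Definition _ (R : realType) (N : nat) :=
  NormedModule.copy (Rn R N) 'rV[R]_N.+1.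
HB.instance Definition _ (R : realType) (N : nat) :=
  Measurable.copy (Rn R N) (caratheodory_type (@lebesgue_outer R N)).

Section lebesgue.
Context (R : realType) (N : nat).

Definition lebesgue : set (Rn R N) -> \bar R := @lebesgue_outer R N.

Let lebesgue_sigma_additive : semi_sigma_additive lebesgue.
Proof.
exact: (@caratheodory_measure_sigma_additive R _ (@lebesgue_outer R N)).
Qed.

HB.instance Definition _ := isMeasure.Build _ (Rn R N) R lebesgue
  (@lebesgue_outer0 R N) (@lebesgue_outer_ge0 R N) lebesgue_sigma_additive.

End lebesgue.
Arguments lebesgue {R N}.

Section function_spaces.
Context (R : realType) (N : nat).
Notation T := (Rn R N).

Definition bounded_domain (Omega : set T) :=
  [/\ Omega !=set0, open Omega, connected Omega & bounded_set Omega].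

Definition kernel_axioms (V : T -> T -> R) :=
  [/\ continuous (fun p : T * T => V p.1 p.2),
      forall x y, 0 <= V x y,
      forall x, 0 < V x x,
      forall x y, V x y = V y x &
      forall x, (\int[lebesgue]_(y in [set: T]) (V x y)%:E = 1)%E].

(* L^p(Omega): only the values on Omega matter, since the function is extended
   by 0; almost everywhere equal functions are not identified. *)
Definition Lp (p : \bar R) (Omega : set T) : set (T -> R) :=
  [set u | patch (fun=> 0) Omega u \in Lfun (@lebesgue R N) p].

Definition ae_equal (Omega : set T) (u v : T -> R) :=
  {ae (@lebesgue R N), forall x, Omega x -> u x = v x}.

Definition W (Omega : set T) : set (T -> R) :=
  [set u | Lp 2%:E Omega u /\ \int[lebesgue]_(x in Omega) u x = 0].

(* meant for v n and w already in L^2(Omega) *)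
Definition weak_L2_cvg (Omega : set T) (v : nat -> T -> R) (w : T -> R) :=
  forall phi, Lp 2%:E Omega phi ->
    \int[lebesgue]_(x in Omega) (v n x * phi x) @[n --> \oo] -->
    \int[lebesgue]_(x in Omega) (w x * phi x).

(* L^oo(Omega) as the dual of L^1(Omega); meant for v n and w already in
   L^oo(Omega) *)
Definition weak_star_Loo_cvg (Omega : set T) (v : nat -> T -> R) (w : T -> R) :=
  forall phi, Lp 1 Omega phi ->
    \int[lebesgue]_(x in Omega) (v n x * phi x) @[n --> \oo] -->
    \int[lebesgue]_(x in Omega) (w x * phi x).

(* The kernels J, G, R are called VJ, VG, VR since R is the field of reals. *)
Definition neumann_solution (VJ VG VR : T -> T -> R) (Omega A B : set T)
    (f u : T -> R) :=
  {ae (@lebesgue R N), forall x, Omega x ->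
    f x = \1_A x * \int[lebesgue]_(y in A) (VJ x y * (u y - u x))
        + \1_A x * \int[lebesgue]_(y in B) (VR x y * (u y - u x))
        + \1_B x * \int[lebesgue]_(y in A) (VR x y * (u y - u x))
        + \1_B x * \int[lebesgue]_(y in B) (VG x y * (u y - u x))}.

Definition limit_system (VJ VG VR : T -> T -> R) (Omega : set T)
    (X f uA uB : T -> R) :=
  {ae (@lebesgue R N), forall x, Omega x ->
    X x * f x =
      \int[lebesgue]_(y in Omega) (VJ x y * (X x * uA y - X y * uA x))
    + \int[lebesgue]_(y in Omega) (VR x y * (X x * uB y - uA x * (1 - X y)))} /\
  {ae (@lebesgue R N), forall x, Omega x ->
    (1 - X x) * f x =
      \int[lebesgue]_(y in Omega) (VR x y * (uA y * (1 - X x) - uB x * X y))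
    + \int[lebesgue]_(y in Omega)
        (VG x y * (uB y * (1 - X x) - uB x * (1 - X y)))}.

Definition zero_mean_pair (Omega : set T) (uA uB : T -> R) :=
  [/\ Lp 2%:E Omega uA, Lp 2%:E Omega uB &
      \int[lebesgue]_(x in Omega) (uA x + uB x) = 0].

(* (uA, uB) is the only pair satisfying P, up to equality a.e. in Omega *)
Definition unique_ae_pair (Omega : set T) (P : (T -> R) -> (T -> R) -> Prop)
    (uA uB : T -> R) :=
  P uA uB /\ forall vA vB, P vA vB ->
    ae_equal Omega vA uA /\ ae_equal Omega vB uB.

End function_spaces.

(* Main.v *)
Require Import Defs.
From HB Require Import structures.
From mathcomp Require Import all_boot all_order all_algebra.
From mathcomp Require Import all_classical all_reals all_analysis.
From mathcomp Require Import measurable_realfun ess_sup_inf ring lra.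

Set Implicit Arguments.
Unset Strict Implicit.
Unset Printing Implicit Defensive.

Import Order.TTheory GRing.Theory Num.Def Num.Theory.
Import numFieldNormedType.Exports.
Local Open Scope classical_set_scope.
Local Open Scope ring_scope.

(** Multiply the equation by the indicators of the two phases: with
    a = \1_A u_n, b = \1_B u_n and D(x) = int_A J(x,y) dy + int_B R(x,y) dy,
    it says, for a.e. x in Omega,
      D a = \1_A (J a + R b - f),
    where V w denotes the function x |-> int_Omega V(x,y) w(y) dy, together with
    the same identity in which J and G, A and B, a and b are exchanged. The limit
    system is what this pair of identities becomes when \1_A is replaced by X and
    \1_B by 1 - X. So everything is said for one half system with an arbitrary
    weight X with values in [0, 1] ([half_system]), used twice, and
    [limit_systemE] and [neumann_half_systems] translate.

    The potentials J a and R b depend continuously on x, uniformly over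
    functions a and b bounded in L^1, because the kernels are uniformly continuous
    on compact sets. Hence along an ultrafilter they converge uniformly on the
    closure of Omega ([potential_ultra_limit]), and so does D, which is bounded
    below by a positive constant ([den_ge]). The only factor of
    a = \1_A (J a + R b - f) / D that converges merely weakly is then \1_A, so
    that a has the weak limit X (P - f) / D, which solves the limit system
    ([half_limit]).

    Uniqueness for the limit system is a maximum principle ([max_principle]).
    In a solution with f = 0 one has uA = X alpha and uB = (1 - X) beta with
    alpha and beta continuous on the closure of Omega. At a point where the
    larger of them reaches its maximum M, the equation makes the integral of a
    nonnegative function vanish, so that near this point X (M - alpha) and
    (1 - X) (M - beta) vanish a.e.; by connectedness they vanish on Omega, hence
    uA + uB = M, and the mean value forces M = 0.

    No bound on u_n is given. The solutions are therefore multiplied by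
    r_n = 1 / (1 + norm of u_n in L^1), which has a limit t along the ultrafilter.
    If t were 0, the limit of the scaled solutions would solve the system with
    f = 0 and mean value 0, hence vanish; the potentials would tend to 0 uniformly
    and the scaled solutions to 0 in L^1, although their norms 1 - r_n tend to 1.
    So t > 0, and dividing by t gives the limit of the unscaled solutions
    ([ultra_limit]). By uniqueness all ultrafilters give the same limit, which is
    thus the limit of the sequence ([weak_limit]). *)

(** * Lebesgue measure on Euclidean space *)

Lemma max_sub_split (R : realDomainType) (a b c : R) :
  maxr 0 (b - a) = maxr 0 (minr b c - a) + maxr 0 (b - maxr a c).
Proof.
case: (leP b c) => bc; case: (leP a c) => ac; do 3?[case: leP => ? /=]; try lra.
Qed.

Section lebesgue_Rn.
Context (R : realType) (N : nat).
Notation T := (Rn R N).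

Definition set_coord (a : T) (i : 'I_N.+1) (c : R) : 'rV[R]_N.+1 :=
  \row_j (if j == i then c else a ord0 j).

Lemma box_volume_split (a b : 'rV[R]_N.+1) i c :
  box_volume a b = box_volume a (set_coord b i (minr (b ord0 i) c))
                 + box_volume (set_coord a i (maxr (a ord0 i) c)) b.
Proof.
rewrite /box_volume !(bigD1 (P := xpredT) i)//= !mxE eqxx.
rewrite [in X in _ = _ * X + _](eq_bigr (fun j => maxr 0 (b ord0 j - a ord0 j))); last first.
  by move=> j /negPf ji; rewrite mxE ji.
rewrite [in X in _ = _ + _ * X](eq_bigr (fun j => maxr 0 (b ord0 j - a ord0 j))); last first.
  by move=> j /negPf ji; rewrite mxE ji.
rewrite -mulrDl; congr (_ * _).
exact: max_sub_split.
Qed.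

Lemma box_volume_ge0 (a b : 'rV[R]_N.+1) : 0 <= box_volume a b.
Proof. by apply: prodr_ge0 => i _; rewrite le_max lexx. Qed.

Lemma boxI_halfspace (a b : 'rV[R]_N.+1) i c :
  box a b `&` [set x | x ord0 i <= c] =
  box a (set_coord b i (minr (b ord0 i) c)).
Proof.
apply/seteqP; split => x /=.
  move=> [xab xc] j; rewrite !mxE; case: eqVneq => [->|_]; last exact: xab.
  by case/andP: (xab i) => -> xb; rewrite le_min xb.
move=> h; split.
  move=> j; have := h j; rewrite !mxE; case: eqVneq => [->|_]//.
  by rewrite le_min => /and3P[-> ->].
by have := h i; rewrite !mxE eqxx le_min => /and3P[].
Qed.

Lemma boxI_halfspaceC (a b : 'rV[R]_N.+1) i c :
  box a b `&` ~` [set x | x ord0 i <= c] =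
  box (set_coord a i (maxr (a ord0 i) c)) b.
Proof.
apply/seteqP; split => x /=.
  move=> [xab /negP]; rewrite -ltNge => xc j; rewrite !mxE; case: eqVneq => [->|_]; last exact: xab.
  by case/andP: (xab i) => ax ->; rewrite gt_max ax xc.
move=> h; split.
  move=> j; have := h j; rewrite !mxE; case: eqVneq => [->|_]//.
  by rewrite gt_max => /andP[/andP[-> _] ->].
have := h i; rewrite !mxE eqxx gt_max => /andP[/andP[_ cx] _].
by apply/negP; rewrite -ltNge.
Qed.

(** A hyperplane cuts a box into two boxes whose volumes add up, so a cover by
    boxes splits into covers of the two sides without increasing the
    total. *)
Lemma measurable_halfspace (i : 'I_N.+1) (c : R) :
  measurable ([set x | x ord0 i <= c] : set T).
Proof.
apply: le_caratheodory_measurable => X.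
apply: le_ereal_inf_tmp => _ [F XF <-].
rewrite (_ : \sum_(k <oo) _ =
   \sum_(k <oo) (box_volume (F k).1 (set_coord (F k).2 i (minr ((F k).2 ord0 i) c)))%:E
  + \sum_(k <oo) (box_volume (set_coord (F k).1 i (maxr ((F k).1 ord0 i) c)) (F k).2)%:E)%E.
  apply: leeD; apply: ereal_inf_lbound.
    exists (fun k => ((F k).1, set_coord (F k).2 i (minr ((F k).2 ord0 i) c))) => //.
    by move=> x [/XF[k _ xk] xc]; exists k => //=; rewrite -boxI_halfspace.
  exists (fun k => (set_coord (F k).1 i (maxr ((F k).1 ord0 i) c), (F k).2)) => //.
  by move=> x [/XF[k _ xk] xc]; exists k => //=; rewrite -boxI_halfspaceC.
rewrite -nneseriesD; last 2 first.
- by move=> k _ _; rewrite lee_fin box_volume_ge0.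
- by move=> k _ _; rewrite lee_fin box_volume_ge0.
by apply: eq_eseriesr => k _; rewrite -EFinD -box_volume_split.
Qed.

Lemma measurable_coord (i : 'I_N.+1) : measurable_fun setT (fun x : T => x ord0 i).
Proof.
apply: (measurability _ (RGenOInfty.measurableE R)) => _ [_ [c ->] <-].
rewrite setTI (_ : _ @^-1` _ = ~` [set x : T | x ord0 i <= c]); last first.
  by apply/seteqP; split => x /=; rewrite in_itv/= andbT ltNge => /negP.
exact/measurableC/measurable_halfspace.
Qed.

Lemma measurable_cube (x : T) (e : R) :
  measurable ([set y : T | forall i, `|x ord0 i - y ord0 i| < e]).
Proof.
rewrite (_ : mkset _ = \bigcap_(i : 'I_N.+1) ((fun y : T => y ord0 i) @^-1` ball (x ord0 i) e)).
  apply: fin_bigcap_measurable => [|i _]; first exact: finite_finset.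
  rewrite -[X in measurable X]setTI; apply: measurable_coord => //.
  exact: measurable_ball.
by apply/seteqP; split => y h i; [move=> _|]; exact: h.
Qed.

Lemma nbhs_cube (x : T) (U : set T) : nbhs x U ->
  exists2 e : R, 0 < e & [set y : T | forall i, `|x ord0 i - y ord0 i| < e] `<=` U.
Proof.
move=> /nbhs_ballP[e e0 eU]; exists e => // y xy; apply: eU.
by split => // i j; rewrite ord1; exact: xy.
Qed.

Lemma rat_approx (a e : R) : 0 < e -> exists q : rat, `|ratr q - a| < e.
Proof.
move=> e0; have /rat_in_itvoo[q] : a - e < a + e by lra.
by rewrite in_itv/= => qa; exists q; rewrite ltr_distl.
Qed.

(** An open set is the union of the countably many cubes with rational centre and
    half-width 1/(k+1) that it contains. *)
Lemma open_measurable_Rn (U : set T) : open U -> measurable U.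
Proof.
move=> oU.
pose C (qk : 'rV[rat]_N.+1 * nat) : set T :=
  [set y : T | forall i, `|ratr (qk.1 ord0 i) - y ord0 i| < qk.2.+1%:R^-1].
pose D qk := if `[< C qk `<=` U >] then C qk else set0.
have -> : U = \bigcup_qk D qk.
  apply/seteqP; split; last first.
    by move=> x [qk _]; rewrite /D; case: asboolP => // /[apply].
  move=> x Ux.
  have [e e0 eU] : exists2 e : R, 0 < e & [set y : T | forall i, `|x ord0 i - y ord0 i| < e] `<=` U.
    exact/nbhs_cube/open_nbhs_nbhs.
  have [k ke] : exists k, k.+1%:R^-1 < e / 2.
    have e2 : 0 < e / 2 by rewrite divr_gt0.
    by have [k _ p] := near_infty_natSinv_lt (PosNum e2); exists k; apply: p => /=.
  have : forall i, exists q : rat, `|ratr q - x ord0 i| < k.+1%:R^-1.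
    by move=> i; apply: rat_approx.
  move=> /choice[q qx].
  exists (\row_i q i, k) => //.
  have Cx : C (\row_i q i, k) x by move=> i; rewrite /= mxE.
  rewrite /D; case: asboolP => // CU; exfalso; apply: CU => y Cy; apply: eU => i.
  move: ke (Cx i) (Cy i); rewrite /= mxE; move: k.+1%:R^-1 => d.
  by rewrite !ltr_norml => ? /andP[? ?] /andP[? ?]; apply/andP; split; lra.
apply: countable_bigcupT_measurable => // qk.
rewrite /D; case: asboolP => // _.
rewrite (_ : C qk = [set y : T | forall i,
    `|(\row_i ratr (qk.1 ord0 i) : T) ord0 i - y ord0 i| < qk.2.+1%:R^-1]).
  exact: measurable_cube.
by apply/seteqP; split => y h i; have := h i; rewrite mxE.
Qed.

Lemma lebesgue_outer_shift (v : 'rV[R]_N.+1) (U : set 'rV[R]_N.+1) :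
  (lebesgue_outer [set x | U (x - v)%R] <= lebesgue_outer U)%E.
Proof.
apply: le_ereal_inf_tmp => _ [F UF <-].
apply: ereal_inf_lbound; exists (fun k => ((F k).1 + v, (F k).2 + v)).
  move=> x /UF[k _ xk]; exists k => //= i.
  by have := xk i; rewrite !mxE ltrBrDr lerBlDr.
apply: eq_eseriesr => k _; congr EFin; apply: eq_bigr => i _.
by rewrite !mxE; congr maxr; ring.
Qed.

(** Countably many translates of a small cube cover the space, so if an open
    set were nonempty and null, everything would be null. Combined with
    [kernel_axioms_lebesgue_neq0], this shows that nonempty open sets have positive
    measure without any lower bound on the outer measure of a box. *)
Lemma open_lebesgue_eq0 (U : set T) : lebesgue [set: T] != 0%E ->
  open U -> lebesgue U = 0%E -> U = set0.
Proof.
move=> T0 oU U0; rewrite -subset0 => x Ux; move/eqP: T0; apply.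
have [e e0 eU] : exists2 e : R, 0 < e & [set y : T | forall i, `|x ord0 i - y ord0 i| < e] `<=` U.
  exact/nbhs_cube/open_nbhs_nbhs.
pose F n : set T := if (unpickle n : option 'rV[rat]_N.+1) is Some q then
  [set y | U (y - (\row_i ratr (q ord0 i) : 'rV[R]_N.+1))] else set0.
have F0 n : lebesgue (F n) = 0%E.
  rewrite /F; case: unpickle => [q|]; last exact: measure0.
  apply/eqP; rewrite eq_le measure_ge0 andbT -U0.
  exact: lebesgue_outer_shift.
have TF : [set: T] `<=` \bigcup_n F n.
  move=> y _.
  have : forall i, exists q : rat, `|ratr q - (y ord0 i - x ord0 i)| < e.
    by move=> i; apply: rat_approx.
  move=> /choice[q qy]; exists (pickle (\row_i q i : 'rV[rat]_N.+1)) => //.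
  rewrite /F pickleK; apply: eU => i; rewrite /= !mxE.
  have := qy i; rewrite !ltr_norml => /andP[? ?]; apply/andP; split; lra.
apply/eqP; rewrite eq_le measure_ge0 andbT.
rewrite (le_trans (le_outer_measure (@lebesgue_outer R N) _ _ TF))//.
rewrite (le_trans (lebesgue_outer_sigma_subadditive _))//.
by rewrite eseries0.
Qed.

Lemma bounded_lebesgue_lty (U : set T) : bounded_set U -> (lebesgue U < +oo)%E.
Proof.
move=> /ex_strict_bound_gt0[M M0 UM].
pose b : 'rV[R]_N.+1 := const_mx M.
have Ub : U `<=` box (- b) b.
  move=> x /UM xM.
  have : ball (0 : T) M x by rewrite -ball_normE /ball_/= sub0r normrN.
  move=> [_ h] i; have := h ord0 i; rewrite /ball/= !mxE sub0r normrN.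
  by move=> /ltr_normlP[? ?]; apply/andP; split; lra.
(* The box (0, 0] is empty and pads the cover. *)
pose F k : 'rV[R]_N.+1 * 'rV[R]_N.+1 := if k is 0 then (- b, b) else (0, 0).
apply: (@le_lt_trans _ _ (\sum_(k <oo) (box_volume (F k).1 (F k).2)%:E)%E).
  by apply: ereal_inf_lbound; exists F => // x /Ub xb; exists 0.
rewrite (nneseries_split 0 1); last by move=> k _; rewrite lee_fin box_volume_ge0.
rewrite eseries0 ?adde0.
  by rewrite add0n big_nat1 ltry.
by move=> [|k]//= _ _; rewrite /box_volume big_ord_recl/= subrr maxxx mul0r.
Qed.

End lebesgue_Rn.

(** * Integrable real functions *)

Section integrals.
Context d (T : measurableType d) (R : realType).
Context (mu : {measure set T -> \bar R}) (D : set T).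
Hypothesis mD : measurable D.
Local Notation L1 f := (mu.-integrable D (EFin \o f)).

Lemma L1_measurable (f : T -> R) : L1 f -> measurable_fun D f.
Proof. by move=> /integrableP[/measurable_EFinP]. Qed.

Lemma L1D (f g : T -> R) : L1 f -> L1 g -> L1 (fun x => f x + g x).
Proof. by move=> lf lg; exact: (integrableD mD lf lg). Qed.

Lemma L1B (f g : T -> R) : L1 f -> L1 g -> L1 (fun x => f x - g x).
Proof. by move=> lf lg; exact: (integrableB mD lf lg). Qed.

Lemma L1Z (c : R) (f : T -> R) : L1 f -> L1 (fun x => c * f x).
Proof. by move=> lf; exact: (integrableZl mD c lf). Qed.

Lemma L1M (M : R) (g f : T -> R) : measurable_fun D g ->
  (forall x, D x -> `|g x| <= M) -> L1 f -> L1 (fun x => g x * f x).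
Proof.
move=> mg gM lf; have bg : [bounded g x | x in D].
  by exists M; split=> [|y My x Dx]; [exact: num_real|exact: le_trans (gM x Dx) (ltW My)].
exact: (integrableMr mD mg bg lf).
Qed.

Lemma L1_cst (c : R) : (mu D < +oo)%E -> L1 (fun=> c).
Proof.
move=> Doo; apply: measurable_bounded_integrable => //.
by exists `|c|; split=> [|y cy x _]; [exact: num_real|exact: ltW].
Qed.

Lemma Rintegral_ae_eq (f g : T -> R) : measurable_fun D f -> measurable_fun D g ->
  {ae mu, forall x, D x -> f x = g x} ->
  \int[mu]_(x in D) f x = \int[mu]_(x in D) g x.
Proof.
move=> mf mg fg; congr fine; apply: ae_eq_integral => //.
- exact/measurable_EFinP.
- exact/measurable_EFinP.
- by apply: filterS fg => x h /h ->.
Qed.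

Lemma le_norm_Rintegral (f g : T -> R) : L1 f -> L1 g ->
  (forall x, D x -> `|f x| <= g x) ->
  `|\int[mu]_(x in D) f x| <= \int[mu]_(x in D) g x.
Proof.
move=> lf lg fg; apply: (le_trans (le_normr_Rintegral _ _)) => //.
by apply: le_Rintegral => //; exact: integrable_norm.
Qed.

Lemma Rintegral_eq0_ae (f : T -> R) : L1 f -> (forall x, D x -> 0 <= f x) ->
  \int[mu]_(x in D) f x = 0 -> {ae mu, forall x, D x -> f x = 0}.
Proof.
move=> lf f0 If0.
have /(ae_eq_integral_abs mu mD) : measurable_fun D (EFin \o f) by case/integrableP: lf.
have -> : (\int[mu]_(x in D) `|(EFin \o f) x| = 0)%E.
  rewrite (eq_integral (EFin \o f)); last first.
    by move=> x /[!inE] Dx /=; rewrite ger0_norm// f0.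
  have := integrable_fin_num mD lf; move: If0; rewrite /Rintegral.
  by case: (integral _ _ _) => //= r ->.
move=> [+ _] => /(_ erefl); apply: filterS => x h Dx.
by have [] := h Dx.
Qed.

End integrals.

(** * Potentials of integrable functions *)

Section kernel_operators.
Context (R : realType) (N : nat) (Omega : set (Rn R N)).
Notation T := (Rn R N).
Hypotheses (oO : open Omega) (bO : bounded_set Omega).
Notation mu := (@lebesgue R N).
Local Notation L1 f := (mu.-integrable Omega (EFin \o f)).
Local Notation K := (closure Omega).

Let mO : measurable Omega. Proof. exact: open_measurable_Rn. Qed.
Let Ooo : (mu Omega < +oo)%E. Proof. exact: bounded_lebesgue_lty. Qed.

Lemma bounded_compact_closure : compact K.
Proof.
apply: (@bounded_closed_compact R N.+1); last exact: closed_closure.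
move: bO => /ex_strict_bound_gt0[M M0 OM].
have cB : closed [set x : T | `|x| <= M].
  by apply: (closed_comp _ (@closed_le R M)) => x _; exact: norm_continuous.
exists M; split=> [|y My x Kx]; first exact: num_real.
apply: le_trans (ltW My).
suff : closure [set x : T | `|x| <= M] x by rewrite -((closure_id _).1 cB).
by apply: closure_subset Kx => z /OM /ltW.
Qed.

Lemma continuous_measurable_Rn (D : set T) (g : T -> R) : continuous g -> measurable_fun D g.
Proof.
move=> cg; apply: (@measurable_funS _ _ _ _ setT) => //.
apply: (measurability _ (RGenOInfty.measurableE R)) => _ [_ [c ->] <-].
rewrite setTI; apply: open_measurable_Rn.
by apply: open_comp; [move=> x _; exact: cg|exact: interval_open].
Qed.

Lemma continuous_bounded_closure (a : T -> R) : continuous a ->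
  exists2 M : R, 0 <= M & forall x, K x -> `|a x| <= M.
Proof.
move=> ca; have /ex_strict_bound_gt0[M M0 aM] : bounded_set (a @` K).
  apply/compact_bounded/continuous_compact; last exact: bounded_compact_closure.
  exact/continuous_subspaceT.
by exists M => [|x Kx]; [exact: ltW|apply/ltW/aM; exists x].
Qed.

Definition kernel_integral (V : T -> T -> R) (w : T -> R) (x : T) :=
  \int[mu]_(y in Omega) (V x y * w y).

Local Notation kint := kernel_integral.

Section one_kernel.
Variable V : T -> T -> R.
Hypothesis cV : continuous (fun p : T * T => V p.1 p.2).

(** Uniform continuity of V on compact sets, in the form used below: the bound
    is uniform in the second variable. *)
Lemma kernel_near (x0 : T) (e : R) : 0 < e ->
  \forall x \near x0, forall y, K y -> `|V x y - V x0 y| < e.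
Proof.
move=> e0.
have /compact_near_coveringP := bounded_compact_closure.
move=> /(_ _ (nbhs x0) (fun x y => `|V x y - V x0 y| < e) _); apply.
move=> y _.
have e2 : 0 < e / 2 by rewrite divr_gt0.
have /cvgrPdist_lt /(_ _ e2) [[U W]/= [Ux Wy] UW] := @cV (x0, y).
exists (W, U) => //= -[y' x'] /= [Wy' Ux'].
have /= h1 := UW (x', y') (conj Ux' Wy').
have /= h2 := UW (x0, y') (conj (nbhs_singleton Ux) Wy').
rewrite distrC in h1.
rewrite (splitr e) (le_lt_trans (ler_distD (V x0 y) _ _))// ltrD//.
Qed.

Lemma kernel_continuous x : continuous (V x).
Proof.
move=> y; apply: (@cvg_comp _ _ _ (fun y : T => (x, y)) (fun p : T * T => V p.1 p.2)
  (nbhs y) (nbhs (x, y))); last exact: (@cV (x, y)).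
exact: (cvg_pair (cvg_cst x) cvg_id).
Qed.

Lemma kernel_mul_L1 x (w : T -> R) : L1 w -> L1 (fun y => V x y * w y).
Proof.
have [M _ VM] := continuous_bounded_closure (@kernel_continuous x).
apply: (@L1M _ _ _ _ _ mO M); first exact/continuous_measurable_Rn/kernel_continuous.
by move=> y Oy; apply/VM/subset_closure.
Qed.

(** The neighbourhood of x0 depends on w only through the bound C on its L^1
    norm: potentials of an L^1-bounded family are equicontinuous. *)
Lemma kint_near (x0 : T) (e C : R) : 0 < e -> \forall x \near x0,
  forall w, L1 w -> \int[mu]_(y in Omega) `|w y| <= C -> `|kint V w x - kint V w x0| <= e.
Proof.
move=> e0; have C1 : 0 < `|C| + 1 by rewrite ltr_wpDl.
have := @kernel_near x0 (e / (`|C| + 1)) (divr_gt0 e0 C1).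
apply: filterS => x h w lw wC.
rewrite /kernel_integral -RintegralB//; [|exact: kernel_mul_L1..].
apply: (@le_trans _ _ (\int[mu]_(y in Omega) (e / (`|C| + 1) * `|w y|))).
  apply: le_norm_Rintegral => //.
  - by apply: L1B => //; exact: kernel_mul_L1.
  - exact/L1Z/integrable_norm.
  move=> y Oy; rewrite -mulrBl normrM ler_wpM2r//.
  exact/ltW/h/subset_closure.
rewrite RintegralZl//; last exact: integrable_norm.
rewrite -mulrA ler_piMr ?(ltW e0)//.
rewrite mulrC ler_pdivrMr// mul1r.
by have := ler_norm C; lra.
Qed.

Lemma kint_continuous w : L1 w -> continuous (kint V w).
Proof.
move=> lw x; have FF := nbhs_filter x; apply/cvgrPdist_le => e e0.
have := @kint_near x e (\int[mu]_(y in Omega) `|w y|) e0.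
by apply: filterS => x' h; rewrite distrC; exact: h.
Qed.

Lemma kint_bounded x : exists2 M : R, 0 <= M & forall w, L1 w ->
  `|kint V w x| <= M * \int[mu]_(y in Omega) `|w y|.
Proof.
have [M M0 VM] := continuous_bounded_closure (@kernel_continuous x).
exists M => // w lw.
rewrite -RintegralZl//; last exact: integrable_norm.
apply: le_norm_Rintegral => //.
- exact: kernel_mul_L1.
- exact/L1Z/integrable_norm.
by move=> y Oy; rewrite normrM ler_wpM2r//; apply: VM; exact: subset_closure.
Qed.

End one_kernel.
End kernel_operators.

(** * The coefficient of the unknown in a half system *)

Section weighted_denominators.
Context (R : realType) (N : nat) (Omega : set (Rn R N)).
Notation T := (Rn R N).
Hypotheses (oO : open Omega) (bO : bounded_set Omega).
Hypothesis open_null : forall U : set T, open U -> lebesgue U = 0%E -> U = set0.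
Notation mu := (@lebesgue R N).
Local Notation L1 f := (mu.-integrable Omega (EFin \o f)).
Local Notation K := (closure Omega).
Local Notation kint := (kernel_integral Omega).

Let mO : measurable Omega. Proof. exact: open_measurable_Rn. Qed.
Let Ooo : (mu Omega < +oo)%E. Proof. exact: bounded_lebesgue_lty. Qed.

Definition admissible_kernel (V : T -> T -> R) :=
  [/\ continuous (fun p : T * T => V p.1 p.2), forall x y, 0 <= V x y
    & forall x, 0 < V x x].

Lemma kernel_gt0_open V x : admissible_kernel V -> open [set y | 0 < V x y].
Proof.
case=> cV _ _; apply: (@open_comp _ _ (V x) [set r | 0 < r]); last exact: open_gt.
by move=> y _; exact: kernel_continuous.
Qed.

Lemma kernel_gt0_nbhs V x : admissible_kernel V -> nbhs x [set y | 0 < V x y].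
Proof.
move=> gV; apply: open_nbhs_nbhs; split; first exact: kernel_gt0_open.
by have [_ _ Vd] := gV; exact: Vd.
Qed.

(** A weight stands for the local proportion of one of the two phases: the
    indicator of A_n, or its weak-* limit. The other phase has weight 1 - X. *)
Definition weight (X : T -> R) :=
  measurable_fun Omega X /\ forall x, Omega x -> 0 <= X x <= 1.

Lemma weightC X : weight X -> weight (fun x => 1 - X x).
Proof.
move=> [mX X01]; split; first exact: measurable_funB.
by move=> x /X01 /andP[? ?]; apply/andP; split; lra.
Qed.

Lemma weight_indic (A : set T) : measurable A -> weight \1_A.
Proof.
move=> mA; split; first exact: measurable_indic.
by move=> x _; rewrite indicE; case: (_ \in _); rewrite ?lexx ?ler01.
Qed.

Lemma weightM_L1 X g : weight X -> L1 g -> L1 (fun x => X x * g x).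
Proof.
move=> [mX X01]; apply: (L1M mO (M := 1)) => // x /X01 /andP[? ?].
by rewrite ger0_norm.
Qed.

Lemma weight_L1 X : weight X -> L1 X.
Proof.
move=> wX; have := weightM_L1 wX (L1_cst mO 1 Ooo).
by under eq_fun do rewrite mulr1.
Qed.

Lemma continuous_L1M (a g : T -> R) : continuous a -> L1 g -> L1 (fun x => a x * g x).
Proof.
move=> ca; have [M _ aM] := continuous_bounded_closure bO ca.
apply: (L1M mO (M := M)) => [|x Ox]; first exact: continuous_measurable_Rn.
by apply: aM; exact: subset_closure.
Qed.

Lemma continuous_L1 (a : T -> R) : continuous a -> L1 a.
Proof.
move=> ca; have := continuous_L1M ca (L1_cst mO 1 Ooo).
by under eq_fun do rewrite mulr1.
Qed.

(** Up to sign, the coefficient of u(x) in the equation on the phase of weight X. *)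
Definition denominator (VJ VR : T -> T -> R) (X : T -> R) (x : T) : R :=
  kint VJ X x + kint VR (fun y => 1 - X y) x.

Local Notation den := denominator.

Lemma den_continuous VJ VR X : admissible_kernel VJ -> admissible_kernel VR -> weight X ->
  continuous (den VJ VR X).
Proof.
move=> [cJ _ _] [cR _ _] wX x; apply: (@continuousD _ R^o).
  exact: (kint_continuous oO bO cJ (weight_L1 wX)).
exact: (kint_continuous oO bO cR (weight_L1 (weightC wX))).
Qed.

(** Whatever the weight, the denominator at x is at least the integral over
    Omega of y |-> min (VJ x y) (VR x y), a positive continuous function of x on the
    compact closure of Omega. The constant is thus the same for all weights. *)
Lemma den_ge VJ VR : Omega !=set0 -> admissible_kernel VJ -> admissible_kernel VR ->
  exists2 c : R, 0 < c & forall X, weight X -> forall x, K x -> c <= den VJ VR X x.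
Proof.
move=> [z Oz] [cJ J0 Jd] [cR R0 Rd].
pose m x y := minr (VJ x y) (VR x y).
have cm : continuous (fun p : T * T => m p.1 p.2).
  by move=> p; apply: continuous_min; [exact: cJ|exact: cR].
have m0 x y : 0 <= m x y by rewrite le_min J0 R0.
have md x : 0 < m x x by rewrite lt_min Jd Rd.
have gm : admissible_kernel m by [].
have L1m x : L1 (fun y => m x y * 1) by apply: kernel_mul_L1 => //; exact: L1_cst.
have K0 : K !=set0 by exists z; exact: subset_closure.
have [x0 /[!inE] Kx0 min0] : exists2 c, c \in K &
    forall t, t \in K -> kint m (fun=> 1) c <= kint m (fun=> 1) t.
  apply: compact_EVT_min => //; first exact: bounded_compact_closure.
  by apply: continuous_subspaceT => x; apply: kint_continuous => //; exact: L1_cst.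
exists (kint m (fun=> 1) x0).
  rewrite lt_neqAle Rintegral_ge0 ?andbT; last by move=> y _; rewrite mulr_ge0.
  apply/eqP => /esym /(Rintegral_eq0_ae mO (L1m x0)) h.
  have oU : open (Omega `&` [set y | 0 < m x0 y]).
    by apply: openI => //; exact: kernel_gt0_open.
  have : Omega `&` [set y | 0 < m x0 y] = set0.
    apply: open_null => //; apply/negligibleP; first exact: open_measurable_Rn.
    apply: negligibleS (h _); last by move=> y _; rewrite mulr_ge0.
    by move=> y [Oy y0] /= /(_ Oy); rewrite mulr1 => y00; rewrite /= y00 ltxx in y0.
  apply/eqP/set0P; apply: Kx0.
  exact: kernel_gt0_nbhs.
move=> X wX x Kx; have [mX X01] := wX.
apply: (le_trans (min0 x _)); first by rewrite inE.
have LJ : L1 (fun y => VJ x y * X y) by apply: kernel_mul_L1 => //; exact: weight_L1.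
have LR : L1 (fun y => VR x y * (1 - X y)).
  by apply: kernel_mul_L1 => //; exact/weight_L1/weightC.
rewrite /denominator /kernel_integral -RintegralD//; apply: le_Rintegral => //; first exact: L1D.
move=> y /X01 /andP[X0 X1].
have mJ : m x y <= VJ x y by rewrite ge_min lexx.
have mR : m x y <= VR x y by rewrite ge_min lexx orbT.
nra.
Qed.

End weighted_denominators.

(** * The maximum principle *)

Section max_principle.
Context (R : realType) (N : nat) (Omega : set (Rn R N)).
Notation T := (Rn R N).
Hypotheses (oO : open Omega) (bO : bounded_set Omega).
Hypotheses (O0 : Omega !=set0) (cO : connected Omega).
Hypothesis open_null : forall U : set T, open U -> lebesgue U = 0%E -> U = set0.
Notation mu := (@lebesgue R N).
Local Notation L1 f := (mu.-integrable Omega (EFin \o f)).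
Local Notation K := (closure Omega).
Local Notation kint := (kernel_integral Omega).
Local Notation den := (denominator Omega).
Local Notation weight := (weight Omega).

Let mO : measurable Omega. Proof. exact: open_measurable_Rn. Qed.
Let Ooo : (mu Omega < +oo)%E. Proof. exact: bounded_lebesgue_lty. Qed.

Lemma ae_closed_open (U S : set T) : open U -> closed S ->
  {ae mu, forall x, U x -> S x} -> U `<=` S.
Proof.
move=> oU cS h; have D0 : U `&` ~` S = set0.
  have oUS : open (U `&` ~` S) by apply: openI => //; exact: closed_openC.
  apply: open_null => //; apply/negligibleP; first exact: open_measurable_Rn.
  by apply: negligibleS h => x [Ux Sx] /(_ Ux).
by move=> x Ux; apply: contrapT => Sx; have : set0 x by rewrite -D0.
Qed.

(** The denominator is bounded below by c on the closure of Omega only;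
    truncating it at c gives quotients that are continuous everywhere. *)
Lemma continuous_div_max (p h : T -> R) (c : R) : 0 < c ->
  continuous p -> continuous h -> continuous (fun x => p x / maxr c (h x)).
Proof.
move=> c0 cp ch x; apply: (@continuousM _ _ p); first exact: cp.
apply: continuousV; first by rewrite gt_eqF// lt_max c0.
by apply: continuous_max; [exact: cst_continuous|exact: ch].
Qed.

(** At x the half system says that the potentials of the nonnegative functions
    X (M - a) and (1 - X) (M - b) add up to 0; they vanish a.e. where VJ x and VR x
    are positive, in particular near x. In the conclusion, y ranges over almost
    all points and x' over a neighbourhood of x, with y = x': this form of the
    statement that a property holds a.e. on a neighbourhood of x can be
    globalized over a compact set by [compact_near_coveringP]. *)
Lemma touching_point VJ VR X a b (M : R) x :
  admissible_kernel VJ -> admissible_kernel VR -> weight X -> continuous a -> continuous b ->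
  (forall y, Omega y -> a y <= M) -> (forall y, Omega y -> b y <= M) ->
  den VJ VR X x * M =
    kint VJ (fun y => X y * a y) x + kint VR (fun y => (1 - X y) * b y) x ->
  \forall x' \near x & y \near almost_everywhere mu, y = x' -> Omega y ->
    X y * (M - a y) = 0 /\ (1 - X y) * (M - b y) = 0.
Proof.
move=> gJ gR wX ca cb aM bM E.
have [[cJ J0 Jd] [cR R0 Rd]] := (gJ, gR).
have [mX X01] := wX.
have wXC := weightC wX.
have lJ (g : T -> R) : L1 g -> L1 (fun y => VJ x y * g y) by exact: kernel_mul_L1.
have lR (g : T -> R) : L1 g -> L1 (fun y => VR x y * g y) by exact: kernel_mul_L1.
have lXM : L1 (fun y => X y * (M - a y)).
  by apply: weightM_L1 => //; apply: L1B => //; [exact: L1_cst|exact: continuous_L1].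
have lXM' : L1 (fun y => (1 - X y) * (M - b y)).
  by apply: (weightM_L1 oO wXC); apply: L1B => //; [exact: L1_cst|exact: continuous_L1].
have IJ : \int[mu]_(y in Omega) (VJ x y * (X y * (M - a y)) + VR x y * ((1 - X y) * (M - b y))) = 0.
  rewrite RintegralD//; [|exact: lJ|exact: lR].
  have -> : \int[mu]_(y in Omega) (VJ x y * (X y * (M - a y))) =
      M * kint VJ X x - kint VJ (fun y => X y * a y) x.
    rewrite /kernel_integral -RintegralZl//; last exact/lJ/weight_L1.
    rewrite -RintegralB//; [|exact/L1Z/lJ/weight_L1|exact/lJ/weightM_L1/continuous_L1].
    by apply: eq_Rintegral => y _; ring.
  have -> : \int[mu]_(y in Omega) (VR x y * ((1 - X y) * (M - b y))) =
      M * kint VR (fun y => 1 - X y) x - kint VR (fun y => (1 - X y) * b y) x.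
    rewrite /kernel_integral -RintegralZl//; last exact/lR/weight_L1.
    rewrite -RintegralB//; [|exact/L1Z/lR/weight_L1|exact/lR/(weightM_L1 oO wXC)/continuous_L1].
    by apply: eq_Rintegral => y _; ring.
  by move: E; rewrite /denominator; lra.
have LS : L1 (fun y => VJ x y * (X y * (M - a y)) + VR x y * ((1 - X y) * (M - b y))).
  by apply: L1D => //; [exact: lJ|exact: lR].
have ge1 y : Omega y -> 0 <= X y * (M - a y).
  by move=> Oy; have /andP[? ?] := X01 y Oy; rewrite mulr_ge0// subr_ge0 aM.
have ge2 y : Omega y -> 0 <= (1 - X y) * (M - b y).
  by move=> Oy; have /andP[? ?] := X01 y Oy; rewrite mulr_ge0 ?subr_ge0// bM.
have H := Rintegral_eq0_ae mO LS.
have {H}H : {ae mu, forall y, Omega y ->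
    VJ x y * (X y * (M - a y)) + VR x y * ((1 - X y) * (M - b y)) = 0}.
  by apply: H => // y Oy; rewrite addr_ge0// mulr_ge0// ?ge1 ?ge2.
have U1 : nbhs x [set y | 0 < VJ x y] by exact: kernel_gt0_nbhs.
have U2 : nbhs x [set y | 0 < VR x y] by exact: kernel_gt0_nbhs.
exists ([set y | 0 < VJ x y] `&` [set y | 0 < VR x y],
  [set y | Omega y -> VJ x y * (X y * (M - a y)) + VR x y * ((1 - X y) * (M - b y)) = 0]).
  by split => //; exact: filterI.
move=> [x' y]/= [[Vx Rx]] h yx' Oy; subst x'.
have := h Oy; have := ge1 y Oy; have := ge2 y Oy.
set s := X y * _; set t := (1 - X y) * _ => t0 s0 st0.
have e1 : VJ x y * s = 0 by nra.
have e2 : VR x y * t = 0 by nra.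
by split; [move/eqP: e1|move/eqP: e2]; rewrite mulf_eq0 gt_eqF//= => /eqP.
Qed.

(** Uniqueness for the limit system without source. The set where one of the
    continuous functions a and b reaches the common maximum M is relatively open
    in Omega by [touching_point], because a property that holds a.e. on an open set
    and defines a closed set holds everywhere on it. *)
Lemma max_principle VJ VG VR X uA uB :
  admissible_kernel VJ -> admissible_kernel VG -> admissible_kernel VR -> weight X ->
  L1 uA -> L1 uB -> \int[mu]_(x in Omega) (uA x + uB x) = 0 ->
  {ae mu, forall x, Omega x ->
     den VJ VR X x * uA x = X x * (kint VJ uA x + kint VR uB x)} ->
  {ae mu, forall x, Omega x ->
     den VG VR (fun y => 1 - X y) x * uB x =
     (1 - X x) * (kint VG uB x + kint VR uA x)} ->
  {ae mu, forall x, Omega x -> uA x = 0 /\ uB x = 0}.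
Proof.
move=> gJ gG gR wX lA lB AB0 EA EB.
have wXC := weightC wX.
have [cA cA0 denA] := den_ge oO bO open_null O0 gJ gR.
have [cB cB0 denB] := den_ge oO bO open_null O0 gG gR.
have [[[cJ _ _] [cG _ _]] [cR _ _]] := (gJ, gG, gR).
pose a x := (kint VJ uA x + kint VR uB x) / maxr cA (den VJ VR X x).
pose b x := (kint VG uB x + kint VR uA x) / maxr cB (den VG VR (fun y => 1 - X y) x).
have ca : continuous a.
  apply: continuous_div_max => //; last exact: den_continuous.
  by move=> x; apply: (@continuousD _ R^o); exact: kint_continuous.
have cb : continuous b.
  apply: continuous_div_max => //; last exact: den_continuous.
  by move=> x; apply: (@continuousD _ R^o); exact: kint_continuous.
have aE x : K x -> den VJ VR X x * a x = kint VJ uA x + kint VR uB x.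
  move=> Kx; have h := denA X wX x Kx; rewrite /a max_r// mulrC divfK//.
  by rewrite gt_eqF// (lt_le_trans cA0).
have bE x : K x -> den VG VR (fun y => 1 - X y) x * b x = kint VG uB x + kint VR uA x.
  move=> Kx; have h := denB _ wXC x Kx; rewrite /b max_r// mulrC divfK//.
  by rewrite gt_eqF// (lt_le_trans cB0).
have uAE : {ae mu, forall x, Omega x -> uA x = X x * a x}.
  apply: filterS EA => x h Ox; have Kx : K x by exact: subset_closure.
  have := denA X wX x Kx => cd.
  by apply: (mulfI (lt0r_neq0 (lt_le_trans cA0 cd))); rewrite h// -aE// mulrCA.
have uBE : {ae mu, forall x, Omega x -> uB x = (1 - X x) * b x}.
  apply: filterS EB => x h Ox; have Kx : K x by exact: subset_closure.
  have := denB _ wXC x Kx => cd.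
  by apply: (mulfI (lt0r_neq0 (lt_le_trans cB0 cd))); rewrite h// -bE// mulrCA.
have [x0 /[!inE] Kx0 max0] : exists2 c, c \in K &
    forall t, t \in K -> maxr (a t) (b t) <= maxr (a c) (b c).
  apply: compact_EVT_max; first by case: O0 => z Oz; exists z; exact: subset_closure.
    exact: bounded_compact_closure.
  by apply: continuous_subspaceT => x; apply: continuous_max; [exact: ca|exact: cb].
set M := maxr (a x0) (b x0) in max0.
have aM x : K x -> a x <= M by move=> /mem_set /max0; rewrite ge_max => /andP[].
have bM x : K x -> b x <= M by move=> /mem_set /max0; rewrite ge_max => /andP[].
pose P y := X y * (M - a y) = 0 /\ (1 - X y) * (M - b y) = 0.
pose S := [set x | a x = M] `|` [set x | b x = M].
have lXa : L1 (fun y => X y * a y) by apply: weightM_L1 => //; exact: continuous_L1.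
have lXb : L1 (fun y => (1 - X y) * b y).
  by apply: (weightM_L1 oO wXC); exact: continuous_L1.
have kA V x : admissible_kernel V -> kint V uA x = kint V (fun y => X y * a y) x.
  move=> [cV _ _]; apply: (Rintegral_ae_eq mO).
  - exact: (L1_measurable (kernel_mul_L1 oO bO cV x lA)).
  - exact: (L1_measurable (kernel_mul_L1 oO bO cV x lXa)).
  by apply: filterS uAE => y h /h ->.
have kB V x : admissible_kernel V -> kint V uB x = kint V (fun y => (1 - X y) * b y) x.
  move=> [cV _ _]; apply: (Rintegral_ae_eq mO).
  - exact: (L1_measurable (kernel_mul_L1 oO bO cV x lB)).
  - exact: (L1_measurable (kernel_mul_L1 oO bO cV x lXb)).
  by apply: filterS uBE => y h /h ->.
have XCC : (fun y => (1 - (1 - X y)) * a y) = (fun y => X y * a y).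
  by apply/funext => y; ring.
have touch x : K x -> S x ->
    \forall x' \near x & y \near almost_everywhere mu, y = x' -> Omega y -> P y.
  move=> Kx [ax|bx].
    apply: (touching_point gJ gR wX ca cb) => [y Oy|y Oy|].
    - exact/aM/subset_closure.
    - exact/bM/subset_closure.
    by rewrite -ax aE// (kA _ _ gJ) (kB _ _ gR).
  have h : \forall x' \near x & y \near almost_everywhere mu, y = x' -> Omega y ->
      (1 - X y) * (M - b y) = 0 /\ (1 - (1 - X y)) * (M - a y) = 0.
    apply: (touching_point gG gR wXC cb ca) => [y Oy|y Oy|].
    - exact/bM/subset_closure.
    - exact/aM/subset_closure.
    by rewrite XCC -bx bE// (kA _ _ gR) (kB _ _ gG).
  apply: filterS h => -[x' y]/= h yx Oy; have [h1 h2] := h yx Oy.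
  by split => //; rewrite -h2; congr (_ * _); ring.
have cS : closed S.
  apply: closedU.
    by apply: (closed_comp _ (@closed_eq R M)) => x _; exact: ca.
  by apply: (closed_comp _ (@closed_eq R M)) => x _; exact: cb.
(* Near a point of S, almost every y is in S: X y and 1 - X y do not both
   vanish. *)
have nS x : K x -> S x -> exists U, [/\ open U, U x & Omega `&` U `<=` S].
  move=> Kx Sx; have [[U Q] /= [Ux Qae] UQ] := touch x Kx Sx.
  exists U°; split; [exact: open_interior|exact: Ux|].
  apply: ae_closed_open => //; first by apply: openI => //; exact: open_interior.
  apply: filterS Qae => y Qy [Oy /interior_subset Uy].
  have [/= p1 p2] := UQ (y, y) (conj Uy Qy) erefl Oy.
  move/eqP: p1; rewrite mulf_eq0 subr_eq0 => /orP[/eqP X0|/eqP Ma]; last by left.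
  by right; move/eqP: p2; rewrite X0 subr0 mul1r subr_eq0 => /eqP.
have OS : Omega `<=` S.
  have : Omega `&` S = Omega; last by move=> <- x [].
  apply: cO.
  - have Sx0 : S x0.
      by rewrite /S /M /Order.max; case: ifP => _; [right|left].
    have [U [oU Ux0 OUS]] := nS x0 Kx0 Sx0.
    have [y [Oy Uy]] := Kx0 U (open_nbhs_nbhs (conj oU Ux0)).
    by exists y; split => //; exact: OUS.
  - exists (\bigcup_(V in [set V | open V /\ Omega `&` V `<=` S]) V).
      by apply: bigcup_open => V [].
    apply/seteqP; split => x [Ox].
      move=> Sx; split=> //; have [|U [oU Ux OUS]] := nS x _ Sx.
        exact: subset_closure.
      by exists U.
    by move=> [V [_ OVS] Vx]; split => //; exact: OVS.
  - by exists S.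
have KS : K `<=` S.
  by rewrite [X in _ `<=` X](closure_id _).1//; exact: closure_subset.
(* S is now the whole closure, and finitely many of the neighbourhoods given by
   touch cover it. *)
have aeP : {ae mu, forall y, Omega y -> P y}.
  have /compact_near_coveringP := bounded_compact_closure bO.
  move=> /(_ _ (almost_everywhere mu) (fun y x' => y = x' -> Omega y -> P y) _).
  move=> /(_ (fun x Kx => touch x Kx (KS x Kx))).
  apply: filterS => y h Oy; apply: (h y) => //; exact: subset_closure.
have MO : M * fine (mu Omega) = 0.
  rewrite -(Rintegral_cst mu mO).
  transitivity (\int[mu]_(x in Omega) (uA x + uB x)); last exact: AB0.
  apply: (Rintegral_ae_eq mO).
  - exact: measurable_cst.
  - exact: (L1_measurable (L1D mO lA lB)).
  apply: filterS3 aeP uAE uBE => y p ya yb Oy.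
  by rewrite ya// yb//; have [] := p Oy; lra.
have M0 : M = 0.
  move/eqP: MO; rewrite mulf_eq0 => /orP[/eqP//|/eqP O00].
  have muO : mu Omega = 0%E by rewrite -(@fineK _ (mu Omega)) ?O00// ge0_fin_numE.
  by exfalso; case: O0 => z; rewrite (open_null oO muO).
move: aeP uAE uBE; apply: filterS3 => y p ya yb Oy; rewrite ya// yb//.
by have [] := p Oy; rewrite M0; lra.
Qed.

End max_principle.

(** * Limits along ultrafilters *)

Section ultrafilters.

Lemma ultra_bounded_cvg (R : realType) I (F : set_system I) (r : I -> R) (M : R) :
  UltraFilter F -> (forall i, `|r i| <= M) -> exists l : R, r @ F --> l.
Proof.
move=> FU rM.
have PF : ProperFilter (r @ F) by apply: fmap_proper_filter.
have [|l [_ lF]] := @segment_compact R (- M) M (r @ F) PF.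
  rewrite /= nbhs_filterE; apply: filterE => i /=; rewrite in_itv/= -ler_norml.
  exact: rM.
exists l => U Ul; have [//|FnU] := in_ultra_setVsetC (r @^-1` U) FU.
by have [z [nUz Uz]] := lF (~` U) U FnU Ul.
Qed.

(** Otherwise some neighbourhood U of l has a preimage outside F; an ultrafilter
    that contains F and the complement of this preimage gives a contradiction. *)
Lemma cvg_ultra (T : topologicalType) I (F : set_system I) (r : I -> T) (l : T) :
  Filter F ->
  (forall G, UltraFilter G -> F `<=` G -> r @ G --> l) -> r @ F --> l.
Proof.
move=> FF h U Ul; apply: contrapT => nFU.
have WF : ProperFilter (within (~` (r @^-1` U)) F).
  apply: Build_ProperFilter_ex.
  move=> P FP; apply: contrapT => nP; apply: nFU.
  suff : F (r @^-1` U) by [].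
  have {}FP : F [set i | (~` (r @^-1` U)) i -> P i] by exact: FP.
  apply: (@filterS _ _ FF _ _ _ FP) => i Pi; apply: contrapT => nU.
  by apply: nP; exists i; exact: Pi.
have [G [GU WG]] := ultraFilterLemma WF.
have FG : F `<=` G.
  by move=> P FP; apply: WG; apply: filterS FP => i Pi _.
have G1 : G (r @^-1` U) by exact: (h G GU FG U Ul).
have G2 : G (~` (r @^-1` U)) by apply: WG; apply: (@filterE _ F FF) => i nU /=.
by have [i []] := filter_ex (filterI G1 G2).
Qed.

End ultrafilters.

(** * Equicontinuous families *)

Section equicontinuity.
Context (R : realType) (T : topologicalType) (I : Type) (F : set_system I).
Context {FF : ProperFilter F}.
Variables (g : I -> T -> R) (g0 : T -> R).
Hypothesis g_equi : forall x0 (e : R), 0 < e ->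
  \forall x \near x0, forall i, `|g i x - g i x0| <= e.
Hypothesis g_cvg : forall x, g i x @[i --> F] --> g0 x.

Lemma limit_equicontinuous x0 (e : R) : 0 < e ->
  \forall x \near x0, `|g0 x - g0 x0| <= e.
Proof.
move=> e0; have e3 : 0 < e / 3 by rewrite divr_gt0.
apply: filterS (g_equi x0 e3) => x h.
have /cvgrPdist_le h1 := @g_cvg x; have {}h1 := h1 _ e3.
have /cvgrPdist_le h2 := @g_cvg x0; have {}h2 := h2 _ e3.
have [i [/= a b]] := filter_ex (filterI h1 h2).
have := h i; move: a b; rewrite !ler_norml.
by move=> /andP[? ?] /andP[? ?] /andP[? ?]; apply/andP; split; lra.
Qed.

Lemma limit_continuous : continuous g0.
Proof.
move=> x; apply/cvgrPdist_le => e e0.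
by apply: filterS (limit_equicontinuous x e0) => y; rewrite distrC.
Qed.

(** Pointwise convergence becomes uniform, as in the Arzela-Ascoli theorem, but
    along an arbitrary proper filter: each point of K has a neighbourhood on which
    g i and g0 move by at most e / 3. *)
Lemma equicontinuous_cvg_uniform (K : set T) (e : R) : compact K -> 0 < e ->
  \forall i \near F, forall x, K x -> `|g i x - g0 x| <= e.
Proof.
move=> /compact_near_coveringP cK e0; have e3 : 0 < e / 3 by rewrite divr_gt0.
apply: (cK _ _ (fun i x => `|g i x - g0 x| <= e)) => x Kx.
have /cvgrPdist_le h1 := @g_cvg x; have {}h1 := h1 _ e3.
exists ([set y | (forall i, `|g i y - g i x| <= e / 3) /\ `|g0 y - g0 x| <= e / 3],
        [set i | `|g0 x - g i x| <= e / 3]).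
  split => //=; apply: filterI; first exact: g_equi.
  exact: limit_equicontinuous.
move=> [y i]/= [[/(_ i) + +]]; rewrite !ler_norml.
by move=> /andP[? ?] /andP[? ?] /andP[? ?]; apply/andP; split; lra.
Qed.

End equicontinuity.

(** * Square integrable functions on a domain *)

Section Lp_spaces.
Context (R : realType) (N : nat) (Omega : set (Rn R N)).
Notation T := (Rn R N).
Hypothesis (mO : measurable Omega).
Notation mu := (@lebesgue R N).
Local Notation L1 f := (mu.-integrable Omega (EFin \o f)).

Lemma Lp1P (g : T -> R) : Lp 1 Omega g <-> L1 g.
Proof.
split.
  move=> /Lfun1_integrable h; apply/(integrable_mkcond _ mO).
  by rewrite restrict_EFin.
move=> /(integrable_mkcond _ mO); rewrite restrict_EFin => h.
exact/Lfun1_integrable.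
Qed.

(** Working with the square avoids real powers and reduces the closure properties
    below to elementary inequalities, such as |g h| <= g^2 + h^2. *)
Lemma Lp2P (g : T -> R) :
  Lp 2%:E Omega g <-> measurable_fun Omega g /\ L1 (fun x => g x ^+ 2).
Proof.
have E : (EFin \o (fun x => g x ^+ 2)) \_ Omega =
    EFin \o (fun x => patch (fun=> 0) Omega g x ^+ 2).
  by apply/funext => x; rewrite /= !patchE; case: ifP => // _; rewrite expr0n.
split.
  move=> h; split.
    apply/(measurable_restrictT _ mO).
    by move: h; rewrite /Lp/= inE => /andP[/[!inE]].
  by apply/(integrable_mkcond _ mO); rewrite E; exact: Lfun2_integrable_sqr.
move=> [mg /(integrable_mkcond _ mO)]; rewrite E => /integrableP[_ lg].
rewrite /Lp/= inE; apply/andP; split; rewrite inE/=.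
  exact/(measurable_restrictT _ mO).
rewrite /finite_norm unlock poweR_lty//.
move: lg; congr (_ < _)%E; apply: eq_integral => x _ /=.
by rewrite normrX powR_mulrn.
Qed.

Lemma Lp2M (M : R) (a g : T -> R) : measurable_fun Omega a ->
  (forall x, Omega x -> `|a x| <= M) -> Lp 2%:E Omega g ->
  Lp 2%:E Omega (fun x => a x * g x).
Proof.
move=> ma aM /Lp2P[mg lg]; apply/Lp2P; split; first exact: measurable_funM.
under eq_fun do rewrite exprMn.
apply: (L1M mO (M := M ^+ 2) _ _ lg); first exact: measurable_funX.
move=> x Ox; rewrite normrX lerXn2r ?nnegrE//; last exact: aM.
exact: le_trans (aM x Ox).
Qed.

Lemma Lp2D (g h : T -> R) : Lp 2%:E Omega g -> Lp 2%:E Omega h ->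
  Lp 2%:E Omega (fun x => g x + h x).
Proof.
move=> /Lp2P[mg lg] /Lp2P[mh lh]; apply/Lp2P; split; first exact: measurable_funD.
have l2 : L1 (fun x => 2 * g x ^+ 2 + 2 * h x ^+ 2).
  by apply: L1D => //; exact: L1Z.
apply: le_integrable l2 => //.
  by apply/measurable_EFinP; apply: measurable_funX; exact: measurable_funD.
move=> x _ /=; rewrite lee_fin ger0_norm ?sqr_ge0// ger0_norm; last first.
  by rewrite addr_ge0// mulr_ge0// sqr_ge0.
by have := sqr_ge0 (g x - h x); nra.
Qed.

Lemma Lp2_mul_L1 (g h : T -> R) : Lp 2%:E Omega g -> Lp 2%:E Omega h ->
  L1 (fun x => g x * h x).
Proof.
move=> /Lp2P[mg lg] /Lp2P[mh lh].
have l2 : L1 (fun x => g x ^+ 2 + h x ^+ 2) by exact: L1D.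
apply: le_integrable l2 => //; first exact/measurable_EFinP/measurable_funM.
move=> x _ /=; rewrite lee_fin [X in _ <= X]ger0_norm ?addr_ge0 ?sqr_ge0// ler_norml.
have := sqr_ge0 (g x - h x); have := sqr_ge0 (g x + h x).
by move=> ? ?; apply/andP; split; nra.
Qed.

Lemma Lp2_cst (c : R) : (mu Omega < +oo)%E -> Lp 2%:E Omega (fun=> c).
Proof. by move=> Ooo; apply/Lp2P; split => //; exact: L1_cst. Qed.

Lemma Lp2_L1 (g : T -> R) : (mu Omega < +oo)%E -> Lp 2%:E Omega g -> L1 g.
Proof.
move=> Ooo lg; have := Lp2_mul_L1 lg (Lp2_cst 1 Ooo).
by under eq_fun do rewrite mulr1.
Qed.

End Lp_spaces.

(** * Weak limits of quotients of potentials *)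

Section weak_limits.
Context (R : realType) (N : nat) (Omega : set (Rn R N)).
Notation T := (Rn R N).
Hypotheses (oO : open Omega) (bO : bounded_set Omega).
Notation mu := (@lebesgue R N).
Local Notation L1 f := (mu.-integrable Omega (EFin \o f)).
Local Notation K := (closure Omega).
Local Notation kint := (kernel_integral Omega).
Local Notation weight := (weight Omega).

Let mO : measurable Omega. Proof. exact: open_measurable_Rn. Qed.
Let Ooo : (mu Omega < +oo)%E. Proof. exact: bounded_lebesgue_lty. Qed.

Section potentials.
Context (I : Type) (V1 V2 : T -> T -> R) (w1 w2 : I -> T -> R) (C : R).
Hypotheses (g1 : admissible_kernel V1) (g2 : admissible_kernel V2).
Hypotheses (lw1 : forall i, L1 (w1 i)) (lw2 : forall i, L1 (w2 i)).
Hypotheses (Cw1 : forall i, \int[mu]_(y in Omega) `|w1 i y| <= C).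
Hypotheses (Cw2 : forall i, \int[mu]_(y in Omega) `|w2 i y| <= C).

Definition potential i x := kint V1 (w1 i) x + kint V2 (w2 i) x.

Lemma potential_equicontinuous x0 (e : R) : 0 < e ->
  \forall x \near x0, forall i, `|potential i x - potential i x0| <= e.
Proof.
move=> e0; have e2 : 0 < e / 2 by rewrite divr_gt0.
have [[c1 _ _] [c2 _ _]] := (g1, g2).
apply: filterS2 (kint_near oO bO c1 x0 C e2) (kint_near oO bO c2 x0 C e2).
move=> x h1 h2 i; have := h1 _ (lw1 i) (Cw1 i); have := h2 _ (lw2 i) (Cw2 i).
rewrite /potential !ler_norml => /andP[? ?] /andP[? ?]; apply/andP; split; lra.
Qed.

Lemma potential_bounded x : exists M, forall i, `|potential i x| <= M.
Proof.
have [[c1 _ _] [c2 _ _]] := (g1, g2).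
have [M1 M10 h1] := kint_bounded oO bO c1 x.
have [M2 M20 h2] := kint_bounded oO bO c2 x.
exists (M1 * C + M2 * C) => i; rewrite (le_trans (ler_normD _ _))// lerD//.
  by rewrite (le_trans (h1 _ (lw1 i)))// ler_wpM2l.
by rewrite (le_trans (h2 _ (lw2 i)))// ler_wpM2l.
Qed.

(** The ultrafilter replaces the choice of a subsequence: bounded real families
    converge along it at every point simultaneously, and equicontinuity makes the
    convergence uniform. *)
Lemma potential_ultra_limit (F : set_system I) : UltraFilter F ->
  exists P : T -> R, [/\ continuous P, forall x, potential i x @[i --> F] --> P x &
    forall e : R, 0 < e -> \forall i \near F, forall x, K x -> `|potential i x - P x| <= e].
Proof.
move=> FU.
have : forall x, exists l : R, potential i x @[i --> F] --> l.
  by move=> x; have [M hM] := potential_bounded x; exact: ultra_bounded_cvg hM.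
move=> /choice[P hP]; exists P; split => //.
  exact: limit_continuous potential_equicontinuous hP.
move=> e e0; apply: (equicontinuous_cvg_uniform potential_equicontinuous hP) => //.
exact: bounded_compact_closure.
Qed.

End potentials.

(** The constant comes from writing the difference as
    ((p - P0) - (t - t0) f) / e + (P0 - t0 f) (e0 - e) / (e e0)
    and using 1 / e <= 1 / c. The factor 1 + |f| is there because f may be unbounded. *)
Lemma quotient_perturbation (P0 p t0 t e0 e f c B eta : R) :
  0 < c -> c <= e -> c <= e0 -> `|P0| <= B -> 0 <= t0 -> `|p - P0| <= eta -> `|t - t0| <= eta ->
  `|e - e0| <= eta ->
  `|(p - t * f) / e - (P0 - t0 * f) / e0| <= eta * (c^-1 + (B + t0) / c ^+ 2) * (1 + `|f|).
Proof.
move=> c0 ce ce0 PB t00 pe te ee.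
have e_gt0 : 0 < e by lra.
have e0_gt0 : 0 < e0 by lra.
have eta0 : 0 <= eta by apply: le_trans ee.
have B0 : 0 <= B by apply: le_trans PB.
have -> : (p - t * f) / e - (P0 - t0 * f) / e0 =
   ((p - P0) - (t - t0) * f) / e + (P0 - t0 * f) * (e0 - e) / (e * e0).
  by field; rewrite !gt_eqF.
have f0 := normr_ge0 f.
apply: (@le_trans _ _ ((eta + eta * `|f|) / c + (B + t0 * `|f|) * eta / c ^+ 2)).
  apply: (le_trans (ler_normD _ _)); apply: lerD.
    rewrite normrM normfV (gtr0_norm e_gt0) ler_pM ?invr_ge0 ?(ltW e_gt0)//.
      by rewrite (le_trans (ler_normB _ _))// lerD// normrM ler_wpM2r.
    by rewrite lef_pV2 ?posrE.
  rewrite normrM normfV (gtr0_norm (mulr_gt0 e_gt0 e0_gt0)).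
  rewrite ler_pM ?invr_ge0 ?mulr_ge0 ?(ltW e_gt0) ?(ltW e0_gt0)//.
    rewrite normrM ler_pM//; last by rewrite distrC.
    by rewrite (le_trans (ler_normB _ _))// lerD// normrM ger0_norm.
  by rewrite lef_pV2 ?posrE ?mulr_gt0 ?exprn_gt0// expr2 ler_pM// ltW.
have ci0 : 0 <= c^-1 by rewrite invr_ge0 ltW.
have ci20 : 0 <= (c ^+ 2)^-1 by rewrite invr_ge0 exprn_ge0 ?ltW.
move: (c^-1) (c ^+ 2)^-1 ci0 ci20 => c1 c2 c10 c20.
rewrite -subr_ge0.
have -> : eta * (c1 + (B + t0) * c2) * (1 + `|f|) -
  ((eta + eta * `|f|) * c1 + (B + t0 * `|f|) * eta * c2) = eta * c2 * (t0 + B * `|f|) by ring.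
by rewrite !mulr_ge0// addr_ge0// mulr_ge0.
Qed.

Lemma div_succ_mul_le (a s : R) : 0 <= a -> 0 <= s -> a / (s + 1) * s <= a.
Proof.
by move=> a0 s0; rewrite mulrAC ler_pdivrMr ?ltr_wpDl// ler_wpM2l// lerDl.
Qed.

Section weighted_limit.
Context (F : set_system nat) {FF : ProperFilter F}.
Variables (Xn : nat -> T -> R) (X : T -> R) (f : T -> R) (tn : nat -> R) (t c : R).
Variables (pn en w : nat -> T -> R) (P e : T -> R).
Hypothesis wXn : forall n, weight (Xn n).
Hypothesis XnX : forall phi, L1 phi ->
  \int[mu]_(x in Omega) (Xn n x * phi x) @[n --> F] -->
  \int[mu]_(x in Omega) (X x * phi x).
Hypotheses (lf : L1 f) (tnt : tn @ F --> t) (t0 : 0 <= t) (c0 : 0 < c).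
Hypotheses (cpn : forall n, continuous (pn n)) (cen : forall n, continuous (en n)).
Hypotheses (cP : continuous P) (ce : continuous e).
Hypotheses (en_ge : forall n x, c <= en n x) (e_ge : forall x, c <= e x).
Hypothesis pnP : forall d : R, 0 < d -> \forall n \near F, forall x, K x -> `|pn n x - P x| <= d.
Hypothesis ene : forall d : R, 0 < d -> \forall n \near F, forall x, K x -> `|en n x - e x| <= d.
Hypothesis lw : forall n, L1 (w n).
Hypothesis wE : forall n, {ae mu, forall x, Omega x ->
  w n x = Xn n x * ((pn n x - tn n * f x) / en n x)}.

Lemma quotient_mul_L1 (p a phi : T -> R) (s : R) : continuous p -> continuous a ->
  (forall x, c <= a x) -> L1 phi -> L1 (fun x => f x * phi x) ->
  L1 (fun x => (p x - s * f x) / a x * phi x).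
Proof.
move=> cp ca ac lphi lfphi.
have cV : continuous (fun x => (a x)^-1).
  by move=> x; apply: continuousV; [rewrite gt_eqF// (lt_le_trans c0)|exact: ca].
have l1 : L1 (fun x => (a x)^-1 * (p x * phi x - s * (f x * phi x))).
  apply: continuous_L1M => //; apply: L1B => //; [exact: continuous_L1M|exact: L1Z].
move: l1; congr (integrable _ _ (EFin \o _)).
by apply/funext => x; ring.
Qed.

Lemma quotient_L1 (p a : T -> R) (s : R) : continuous p -> continuous a ->
  (forall x, c <= a x) -> L1 (fun x => (p x - s * f x) / a x).
Proof.
move=> cp ca ac.
have lf1 : L1 (fun x => f x * 1) by under eq_fun do rewrite mulr1.
have := quotient_mul_L1 s cp ca ac (L1_cst mO 1 Ooo) lf1.
by congr (integrable _ _ (EFin \o _)); apply/funext => x; rewrite mulr1.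
Qed.

(** The quotients (pn - tn f) / en converge to (P - t f) / e uniformly up to the
    integrable factor (1 + |f|) |phi|, so they may be replaced by their limit,
    and then only the weights Xn depend on n. *)
Lemma weighted_limit phi : L1 phi -> L1 (fun x => f x * phi x) ->
  \int[mu]_(x in Omega) (w n x * phi x) @[n --> F] -->
  \int[mu]_(x in Omega) (X x * ((P x - t * f x) / e x) * phi x).
Proof.
move=> lphi lfphi.
have [B B0 PB] := continuous_bounded_closure bO cP.
pose zphi x := (P x - t * f x) / e x * phi x.
pose znphi n x := (pn n x - tn n * f x) / en n x * phi x.
have lz : L1 zphi by exact: quotient_mul_L1.
have lzn n : L1 (znphi n) by exact: quotient_mul_L1.
pose D := c^-1 + (B + t) / c ^+ 2.
have D0 : 0 <= D.
  by rewrite addr_ge0 ?divr_ge0 ?exprn_ge0 ?invr_ge0 ?(ltW c0)// addr_ge0.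
pose h x := (1 + `|f x|) * `|phi x|.
have lh : L1 h.
  have := L1D mO (integrable_norm lphi) (integrable_norm lfphi).
  by congr (integrable _ _ (EFin \o _)); apply/funext => x; rewrite /h/= normrM; ring.
pose S := \int[mu]_(x in Omega) h x.
have S0 : 0 <= S by apply: Rintegral_ge0 => x _; rewrite mulr_ge0// addr_ge0.
have DS0 : 0 <= D * S by rewrite mulr_ge0.
have -> : \int[mu]_(x in Omega) (X x * ((P x - t * f x) / e x) * phi x) =
    \int[mu]_(x in Omega) (X x * zphi x).
  by apply: eq_Rintegral => x _; rewrite /zphi; ring.
apply/cvgrPdist_le => eps eps0.
have eps2 : 0 < eps / 2 by rewrite divr_gt0.
pose eta := eps / 2 / (D * S + 1).
have eta0 : 0 < eta by rewrite divr_gt0// ltr_wpDl.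
near=> n.
have h1 : `|\int[mu]_(x in Omega) (X x * zphi x) -
             \int[mu]_(x in Omega) (Xn n x * zphi x)| <= eps / 2.
  by near: n; have /cvgrPdist_le := XnX lz; apply.
have hp : forall x, K x -> `|pn n x - P x| <= eta by near: n; exact: pnP.
have he : forall x, K x -> `|en n x - e x| <= eta by near: n; exact: ene.
have ht : `|tn n - t| <= eta.
  by rewrite distrC; near: n; have /cvgrPdist_le := tnt; apply.
have wphi : \int[mu]_(x in Omega) (w n x * phi x) = \int[mu]_(x in Omega) (Xn n x * znphi n x).
  apply: (Rintegral_ae_eq mO).
  - apply: measurable_funM; [exact: (L1_measurable (lw n))|exact: (L1_measurable lphi)].
  - exact: (L1_measurable (weightM_L1 oO (wXn n) (lzn n))).
  by apply: filterS (wE n) => x hx Ox; rewrite hx// /znphi !mulrA.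
have h2 : `|\int[mu]_(x in Omega) (Xn n x * zphi x) -
             \int[mu]_(x in Omega) (w n x * phi x)| <= eps / 2.
  rewrite wphi.
  have lXz := weightM_L1 oO (wXn n) lz.
  have lXzn := weightM_L1 oO (wXn n) (lzn n).
  rewrite -(RintegralB mO lXz lXzn).
  apply: (@le_trans _ _ (\int[mu]_(x in Omega) (eta * D * h x))).
    apply: (le_norm_Rintegral mO); [exact: L1B|exact: L1Z|].
    move=> x Ox; have [_ /(_ x Ox)/andP[X0 X1]] := wXn n.
    rewrite -mulrBr -mulrBl !normrM ger0_norm// /h mulrA distrC.
    have Kx : K x by exact: subset_closure.
    have q := quotient_perturbation (f x) c0 (en_ge n x) (e_ge x) (PB x Kx) t0
       (hp x Kx) ht (he x Kx).
    rewrite mulrA -[leLHS]mul1r !mulrA ler_wpM2r// mul1r.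
    apply: (le_trans _ q); rewrite -[leRHS]mul1r ler_wpM2r//.
  by rewrite (RintegralZl _ mO lh) -/S -mulrA; apply: div_succ_mul_le => //; exact: ltW.
rewrite (splitr eps).
exact: le_trans (ler_distD (\int[mu]_(x in Omega) (Xn n x * zphi x)) _ _) (lerD h1 h2).
Unshelve. all: by end_near. Qed.

(** With P = 0 and t = 0, the estimate of the quotients bounds |w n| itself by a
    small multiple of 1 + |f|. *)
Lemma strong_limit0 (d : R) : t = 0 -> (forall x, P x = 0) -> 0 < d ->
  \forall n \near F, \int[mu]_(x in Omega) `|w n x| <= d.
Proof.
move=> tE PE d0.
pose h x := 1 + `|f x|.
have lh : L1 h by apply: L1D => //; [exact: L1_cst|exact: integrable_norm].
pose S := \int[mu]_(x in Omega) h x.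
have S0 : 0 <= S by apply: Rintegral_ge0 => x _; rewrite addr_ge0.
have ci0 : 0 < c^-1 by rewrite invr_gt0.
have DS0 : 0 <= c^-1 * S by rewrite mulr_ge0// ltW.
pose eta := d / (c^-1 * S + 1).
have eta0 : 0 < eta by rewrite divr_gt0// ltr_wpDl.
near=> n.
have hp : forall x, K x -> `|pn n x - P x| <= eta by near: n; exact: pnP.
have he : forall x, K x -> `|en n x - e x| <= eta by near: n; exact: ene.
have ht : `|tn n - t| <= eta.
  by rewrite distrC; near: n; have /cvgrPdist_le := tnt; apply.
have lz : L1 (fun x => (pn n x - tn n * f x) / en n x) by exact: quotient_L1.
have lXz := weightM_L1 oO (wXn n) lz.
have -> : \int[mu]_(x in Omega) `|w n x| =
    \int[mu]_(x in Omega) `|Xn n x * ((pn n x - tn n * f x) / en n x)|.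
  apply: (Rintegral_ae_eq mO).
  - exact: (L1_measurable (integrable_norm (lw n))).
  - exact: (L1_measurable (integrable_norm lXz)).
  by apply: filterS (wE n) => x hx Ox; rewrite hx.
apply: (@le_trans _ _ (\int[mu]_(x in Omega) (eta * c^-1 * h x))).
  apply: (le_Rintegral mO); [exact: (integrable_norm lXz)|exact: L1Z|].
  move=> x Ox; have [_ /(_ x Ox)/andP[X0 X1]] := wXn n.
  have Kx : K x by exact: subset_closure.
  have PB : `|P x| <= 0 by rewrite PE normr0.
  have := quotient_perturbation (f x) c0 (en_ge n x) (e_ge x) PB t0 (hp x Kx) ht (he x Kx).
  rewrite PE tE mul0r !subr0 !(mul0r, addr0) subr0 => q.
  rewrite normrM ger0_norm//; apply: (le_trans _ q).
  by rewrite -[leRHS]mul1r ler_wpM2r.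
by rewrite (RintegralZl _ mO lh) -/S -mulrA; apply: div_succ_mul_le => //; exact: ltW.
Unshelve. all: by end_near. Qed.

End weighted_limit.
End weak_limits.

(** * Limits of one half system *)

Section domain.
Context (R : realType) (N : nat) (Omega : set (Rn R N)).
Notation T := (Rn R N).
Hypotheses (oO : open Omega) (bO : bounded_set Omega).
Hypotheses (O0 : Omega !=set0) (cO : connected Omega).
Hypothesis open_null : forall U : set T, open U -> lebesgue U = 0%E -> U = set0.
Notation mu := (@lebesgue R N).
Local Notation L1 f := (mu.-integrable Omega (EFin \o f)).
Local Notation K := (closure Omega).
Local Notation kint := (kernel_integral Omega).
Local Notation den := (denominator Omega).
Local Notation weight := (weight Omega).
Local Notation potential := (potential Omega).

Let mO : measurable Omega. Proof. exact: open_measurable_Rn. Qed.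
Let Ooo : (mu Omega < +oo)%E. Proof. exact: bounded_lebesgue_lty. Qed.

Lemma kintZ V w c x : admissible_kernel V -> L1 w ->
  kint V (fun y => c * w y) x = c * kint V w x.
Proof.
move=> [cV _ _] lw; rewrite /kernel_integral -(RintegralZl _ mO (kernel_mul_L1 oO bO cV x lw)).
by apply: eq_Rintegral => y _; rewrite mulrCA.
Qed.

Lemma kintB V w w' x : admissible_kernel V -> L1 w -> L1 w' ->
  kint V (fun y => w y - w' y) x = kint V w x - kint V w' x.
Proof.
move=> [cV _ _] lw lw'.
have [l l'] := (kernel_mul_L1 oO bO cV x lw, kernel_mul_L1 oO bO cV x lw').
rewrite /kernel_integral -(RintegralB mO l l').
by apply: eq_Rintegral => y _; rewrite mulrBr.
Qed.

Lemma kint_L1_fun V x : admissible_kernel V -> L1 (V x).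
Proof.
by move=> [cV _ _]; apply: continuous_L1 => // y; exact: kernel_continuous.
Qed.

Lemma weight_norm_le X : weight X -> \int[mu]_(y in Omega) `|X y| <= fine (mu Omega).
Proof.
move=> wX; rewrite -[leRHS]mul1r -(Rintegral_cst mu mO 1).
apply: (le_Rintegral mO); [exact: (integrable_norm (weight_L1 oO bO wX))|exact: L1_cst|].
by move=> x Ox; have [_ /(_ x Ox)/andP[? ?]] := wX; rewrite ger0_norm.
Qed.

Lemma weight_compl_cvg (F : set_system nat) {FF : ProperFilter F} Xn X :
  (forall n, weight (Xn n)) -> weight X ->
  (forall phi, L1 phi -> \int[mu]_(x in Omega) (Xn n x * phi x) @[n --> F] -->
     \int[mu]_(x in Omega) (X x * phi x)) ->
  forall phi, L1 phi -> \int[mu]_(x in Omega) ((1 - Xn n x) * phi x) @[n --> F] -->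
     \int[mu]_(x in Omega) ((1 - X x) * phi x).
Proof.
move=> wXn wX XnX phi lphi.
have E Y : weight Y -> \int[mu]_(x in Omega) ((1 - Y x) * phi x) =
    \int[mu]_(x in Omega) phi x - \int[mu]_(x in Omega) (Y x * phi x).
  move=> wY; rewrite -(RintegralB mO lphi (weightM_L1 oO wY lphi)).
  by apply: eq_Rintegral => x _; ring.
rewrite (E X wX); under eq_cvg do rewrite (E _ (wXn _)).
by apply: cvgB; [exact: cvg_cst|exact: XnX].
Qed.

(** Pointwise, the convergence is that of the weights tested on VJ x and VR x;
    denominators are potentials of weights, hence equicontinuous. *)
Lemma den_cvg_uniform (F : set_system nat) {FF : ProperFilter F} VJ VR Xn X :
  admissible_kernel VJ -> admissible_kernel VR -> (forall n, weight (Xn n)) -> weight X ->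
  (forall phi, L1 phi -> \int[mu]_(x in Omega) (Xn n x * phi x) @[n --> F] -->
     \int[mu]_(x in Omega) (X x * phi x)) ->
  forall d : R, 0 < d -> \forall n \near F, forall x, K x ->
     `|den VJ VR (Xn n) x - den VJ VR X x| <= d.
Proof.
move=> gJ gR wXn wX XnX d d0.
have wXnC n := weightC (wXn n).
apply: (@equicontinuous_cvg_uniform R T nat F FF (fun n => den VJ VR (Xn n)) (den VJ VR X)) => //.
- move=> x0 e e0.
  apply: (@potential_equicontinuous R N Omega oO bO nat VJ VR Xn (fun n y => 1 - Xn n y)
    (fine (mu Omega)) gJ gR) => // n.
  + exact: weight_L1.
  + exact: weight_L1.
  + exact: weight_norm_le.
  + exact: weight_norm_le.
- move=> x; rewrite /denominator.
  have h (V : T -> T -> R) (w : T -> R) : kint V w x = \int[mu]_(y in Omega) (w y * V x y).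
    by apply: eq_Rintegral => y _; rewrite mulrC.
  rewrite !h; under eq_cvg do rewrite !h.
  apply: cvgD; first exact/XnX/kint_L1_fun.
  exact: (weight_compl_cvg wXn wX XnX (kint_L1_fun x gR)).
exact: bounded_compact_closure.
Qed.

Lemma dist_max_le (c a b : R) : `|maxr c a - maxr c b| <= `|a - b|.
Proof.
case: (leP c a) => ca; case: (leP c b) => cb //.
- by rewrite !ger0_norm; lra.
- by rewrite distrC [leRHS]distrC !ger0_norm; lra.
- by rewrite subrr normr0.
Qed.

Section half_limit.
Context (F : set_system nat) (FU : UltraFilter F).
Variables (VJ VR : T -> T -> R) (Xn : nat -> T -> R) (X f : T -> R).
Variables (rn : nat -> R) (t C : R) (wa wb : nat -> T -> R).
Hypotheses (gJ : admissible_kernel VJ) (gR : admissible_kernel VR).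
Hypotheses (wXn : forall n, weight (Xn n)) (wX : weight X).
Hypothesis XnX : forall phi, L1 phi ->
  \int[mu]_(x in Omega) (Xn n x * phi x) @[n --> F] --> \int[mu]_(x in Omega) (X x * phi x).
Hypotheses (lf : Lp 2%:E Omega f) (rnt : rn @ F --> t) (t0 : 0 <= t).
Hypotheses (lwa : forall n, L1 (wa n)) (lwb : forall n, L1 (wb n)).
Hypotheses (Cwa : forall i, \int[mu]_(y in Omega) `|wa i y| <= C).
Hypotheses (Cwb : forall i, \int[mu]_(y in Omega) `|wb i y| <= C).
Hypothesis wE : forall n, {ae mu, forall x, Omega x ->
  den VJ VR (Xn n) x * wa n x = Xn n x * (potential VJ VR wa wb n x - rn n * f x)}.

(** The candidate for the weak limit is X (P - t f) / D, where P is the uniform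
    limit of the potentials. P is kept in the conclusion because its expression in
    terms of the weak limits uA and uB needs both half systems. *)
Lemma half_limit : exists P uA : T -> R,
  [/\ forall x, potential VJ VR wa wb n x @[n --> F] --> P x,
      Lp 2%:E Omega uA,
      forall x, Omega x -> den VJ VR X x * uA x = X x * (P x - t * f x),
      forall phi, L1 phi -> L1 (fun x => f x * phi x) ->
       \int[mu]_(x in Omega) (wa n x * phi x) @[n --> F] -->
       \int[mu]_(x in Omega) (uA x * phi x) &
      t = 0 -> (forall x, P x = 0) -> forall d : R, 0 < d ->
       \forall n \near F, \int[mu]_(x in Omega) `|wa n x| <= d].
Proof.
have [P [cP Pcvg Punif]] := potential_ultra_limit oO bO gJ gR lwa lwb Cwa Cwb FU.
have [c c0 cden] := den_ge oO bO open_null O0 gJ gR.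
pose e X x := maxr c (den VJ VR X x).
have ce Y : weight Y -> continuous (e Y).
  move=> wY x; apply: continuous_max; first exact: cst_continuous.
  exact: den_continuous.
have ege Y x : c <= e Y x by rewrite /e le_max lexx.
have e0 Y x : 0 < e Y x by apply: lt_le_trans (ege Y x).
have eE Y x : weight Y -> K x -> e Y x = den VJ VR Y x.
  by move=> wY Kx; rewrite /e max_r// cden.
have cpot n : continuous (potential VJ VR wa wb n).
  have [[cJ _ _] [cR _ _]] := (gJ, gR).
  by move=> x; apply: (@continuousD _ R^o); exact: kint_continuous.
have wE' n : {ae mu, forall x, Omega x ->
  wa n x = Xn n x * ((potential VJ VR wa wb n x - rn n * f x) / e (Xn n) x)}.
  apply: filterS (wE n) => x h Ox; have Kx : K x by exact: subset_closure.
  by rewrite mulrA -h// -(eE _ _ (wXn n) Kx) mulrC mulKf// gt_eqF.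
have eunif (d : R) : 0 < d -> \forall n \near F, forall x, K x -> `|e (Xn n) x - e X x| <= d.
  move=> d0; apply: filterS (den_cvg_uniform gJ gR wXn wX XnX d0) => n h x Kx.
  by apply: le_trans (h x Kx); exact: dist_max_le.
have lf1 : L1 f by exact: Lp2_L1.
have cen n : continuous (e (Xn n)) by exact: ce.
exists P, (fun x => X x * ((P x - t * f x) / e X x)); split => //.
- have ciV : continuous (fun x => (e X x)^-1).
    by move=> x; apply: continuousV; [rewrite gt_eqF|exact: ce].
  have [B B0 PB] := continuous_bounded_closure bO cP.
  have lPf : Lp 2%:E Omega (fun x => P x * 1 + (- t) * f x).
    apply: Lp2D => //.
      apply: (Lp2M mO (M := B)); [exact: continuous_measurable_Rn| |exact: Lp2_cst].
      by move=> x Ox; apply: PB; exact: subset_closure.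
    by apply: (Lp2M mO (M := `|t|) _ _ lf) => [|x _]; [exact: measurable_cst|rewrite normrN].
  have lq : Lp 2%:E Omega (fun x => (X x * (e X x)^-1) * (P x * 1 + (- t) * f x)).
    apply: (Lp2M mO (M := c^-1) _ _ lPf).
      by apply: measurable_funM; [case: wX|exact: continuous_measurable_Rn].
    move=> x Ox; have [_ /(_ x Ox)/andP[X0 X1]] := wX.
    rewrite normrM ger0_norm// ger0_norm ?invr_ge0 ?(ltW (e0 _ _))//.
    rewrite -[leRHS]mul1r ler_pM ?invr_ge0 ?(ltW (e0 _ _))//.
    by rewrite lef_pV2 ?posrE.
  by move: lq; congr (Lp _ _ _); apply/funext => x; ring.
- move=> x Ox; have Kx : K x by exact: subset_closure.
  by rewrite -(eE _ _ wX Kx) mulrCA [X in _ * X = _]mulrC divfK// gt_eqF.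
- move=> phi lphi lfphi.
  exact: (weighted_limit oO bO wXn XnX rnt t0 c0 cpot cen cP (ce _ wX)
    (fun n => ege (Xn n)) (ege X) Punif eunif lwa wE').
- move=> tE PE d d0.
  exact: (strong_limit0 oO bO wXn lf1 rnt t0 c0 cpot cen
    (fun n => ege (Xn n)) (ege X) Punif eunif lwa wE').
Qed.

End half_limit.

(** * The two half systems together *)

(** The equation on the phase of weight X, where VJ acts inside the phase and VR
    between the phases. The other phase satisfies the same equation with VG,
    1 - X, uB and uA in the place of VJ, X, uA and uB. *)
Definition half_system (VJ VR : T -> T -> R) (X f uA uB : T -> R) :=
  {ae mu, forall x, Omega x ->
    den VJ VR X x * uA x = X x * (kint VJ uA x + kint VR uB x - f x)}.

Definition limit_pair (VJ VG VR : T -> T -> R) (X f uA uB : T -> R) :=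
  [/\ Lp 2%:E Omega uA, Lp 2%:E Omega uB,
      \int[mu]_(x in Omega) (uA x + uB x) = 0,
      half_system VJ VR X f uA uB
    & half_system VG VR (fun y => 1 - X y) f uB uA].

Section two_phases.
Variables (VJ VG VR : T -> T -> R).
Hypotheses (gJ : admissible_kernel VJ) (gG : admissible_kernel VG) (gR : admissible_kernel VR).

Lemma limit_pair_unique X f uA uB vA vB : weight X ->
  limit_pair VJ VG VR X f uA uB -> limit_pair VJ VG VR X f vA vB ->
  {ae mu, forall x, Omega x -> uA x = vA x /\ uB x = vB x}.
Proof.
move=> wX [luA luB u0 huA huB] [lvA lvB v0 hvA hvB].
have [l1 l2] := (Lp2_L1 mO Ooo luA, Lp2_L1 mO Ooo luB).
have [l3 l4] := (Lp2_L1 mO Ooo lvA, Lp2_L1 mO Ooo lvB).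
have lA := L1B mO l1 l3; have lB := L1B mO l2 l4.
suff : {ae mu, forall x, Omega x -> uA x - vA x = 0 /\ uB x - vB x = 0}.
  apply: filterS => x h Ox; have [/eqP a0 /eqP b0] := h Ox.
  by split; apply/eqP; rewrite -subr_eq0.
apply: (max_principle oO bO O0 cO open_null gJ gG gR wX lA lB).
- have : \int[mu]_(x in Omega) ((uA x + uB x) - (vA x + vB x)) = 0.
    by rewrite (RintegralB mO (L1D mO l1 l2) (L1D mO l3 l4)) u0 v0 subrr.
  by move=> <-; apply: eq_Rintegral => x _; ring.
- move: huA hvA; apply: filterS2 => x h1 h2 Ox.
  rewrite (kintB x gJ l1 l3) (kintB x gR l2 l4).
  by rewrite mulrBr (h1 Ox) (h2 Ox); ring.
- move: huB hvB; apply: filterS2 => x h1 h2 Ox.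
  rewrite (kintB x gG l2 l4) (kintB x gR l1 l3).
  by rewrite mulrBr (h1 Ox) (h2 Ox); ring.
Qed.

Variables (Xn : nat -> T -> R) (X f : T -> R) (u : nat -> T -> R).
Hypotheses (wXn : forall n, weight (Xn n)) (wX : weight X).
Hypothesis XnX : forall phi, L1 phi ->
  \int[mu]_(x in Omega) (Xn n x * phi x) @[n --> \oo] --> \int[mu]_(x in Omega) (X x * phi x).
Hypotheses (lf : Lp 2%:E Omega f) (lu2 : forall n, Lp 2%:E Omega (u n)).
Hypothesis u0 : forall n, \int[mu]_(x in Omega) u n x = 0.
Hypothesis EA : forall n,
  half_system VJ VR (Xn n) f (fun y => Xn n y * u n y) (fun y => (1 - Xn n y) * u n y).
Hypothesis EB : forall n,
  half_system VG VR (fun y => 1 - Xn n y) f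
    (fun y => (1 - Xn n y) * u n y) (fun y => Xn n y * u n y).

Let lu n : L1 (u n). Proof. exact: (Lp2_L1 mO Ooo). Qed.
Let wXnC n : weight (fun y => 1 - Xn n y). Proof. exact: weightC. Qed.
Let lXu n : L1 (fun y => Xn n y * u n y). Proof. exact: weightM_L1. Qed.
Let lXCu n : L1 (fun y => (1 - Xn n y) * u n y).
Proof. exact: (weightM_L1 oO (wXnC n) (lu n)). Qed.

(* r n * u n has L^1 norm 1 - r n, whatever the size of u n. *)
Let s n := \int[mu]_(x in Omega) `|u n x|.
Let r n := (1 + s n)^-1.
Let s0 n : 0 <= s n. Proof. exact: Rintegral_ge0. Qed.
Let r0 n : 0 < r n. Proof. by rewrite invr_gt0 ltr_wpDr. Qed.
Let rs n : r n * s n = 1 - r n.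
Proof. by rewrite /r; field; rewrite gt_eqF// ltr_wpDr. Qed.

Lemma scaled_norm_le n Y : weight Y -> L1 (fun y => Y y * u n y) ->
  \int[mu]_(y in Omega) `|r n * (Y y * u n y)| <= 1.
Proof.
move=> wY lY; apply: (@le_trans _ _ (\int[mu]_(y in Omega) (r n * `|u n y|))).
  apply: (le_Rintegral mO).
  - exact: (integrable_norm (L1Z mO (r n) lY)).
  - exact: (L1Z mO (r n) (integrable_norm (lu n))).
  move=> x Ox; rewrite normrM (ger0_norm (ltW (r0 n))) ler_wpM2l ?(ltW (r0 n))//.
  have [_ /(_ x Ox)/andP[Y0 Y1]] := wY.
  by rewrite normrM ger0_norm// ler_piMl.
rewrite (RintegralZl _ mO (integrable_norm (lu n))) rs.
by have := r0 n; lra.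
Qed.

Lemma half_system_scaled n VA VB Y w1 w2 : admissible_kernel VA -> admissible_kernel VB ->
  L1 w1 -> L1 w2 -> half_system VA VB Y f w1 w2 ->
  {ae mu, forall x, Omega x -> den VA VB Y x * (r n * w1 x) =
    Y x * (kint VA (fun y => r n * w1 y) x + kint VB (fun y => r n * w2 y) x - r n * f x)}.
Proof.
move=> gA gB l1 l2; apply: filterS => x h Ox.
by rewrite (kintZ _ x gA l1) (kintZ _ x gB l2) mulrCA h//; ring.
Qed.

(** The potentials of the scaled solutions converge to P and Q; testing the weak
    convergence against VJ x, VR x and VG x identifies P and Q with the potentials
    of the weak limits, so that the weak limits solve the system with source
    t f. *)
Lemma ultra_limit (F : set_system nat) : UltraFilter F -> \oo `<=` F ->
  exists uA uB, limit_pair VJ VG VR X f uA uB /\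
    forall phi, Lp 2%:E Omega phi ->
     (\int[mu]_(x in Omega) ((Xn n x * u n x) * phi x) @[n --> F] -->
       \int[mu]_(x in Omega) (uA x * phi x)) /\
     (\int[mu]_(x in Omega) (((1 - Xn n x) * u n x) * phi x) @[n --> F] -->
       \int[mu]_(x in Omega) (uB x * phi x)).
Proof.
move=> FU oF.
have XnXF phi : L1 phi ->
    \int[mu]_(x in Omega) (Xn n x * phi x) @[n --> F] --> \int[mu]_(x in Omega) (X x * phi x).
  by move=> lphi U Ul; apply: oF; exact: (XnX lphi Ul).
have wXC := weightC wX.
have PF : ProperFilter F by exact: ultra_proper.
have XnXFC := @weight_compl_cvg F PF Xn X wXn wX XnXF.
have [t rt] : exists t : R, r @ F --> t.
  apply: (@ultra_bounded_cvg R nat F r 1 FU) => n.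
  by rewrite gtr0_norm// invf_le1 ?ltr_wpDr// lerDl.
have t0 : 0 <= t.
  have r_ge0 : \forall n \near F, 0 <= r n by apply: filterE => n; exact: ltW.
  exact: (@closed_cvg _ _ F _ r (fun x : R => 0 <= x) (@closed_ge R 0) r_ge0 t rt).
pose wa n y := r n * (Xn n y * u n y).
pose wb n y := r n * ((1 - Xn n y) * u n y).
have lwa n : L1 (wa n) by exact: L1Z.
have lwb n : L1 (wb n) by exact: L1Z.
have Cwa n : \int[mu]_(y in Omega) `|wa n y| <= 1 by exact: scaled_norm_le.
have Cwb n : \int[mu]_(y in Omega) `|wb n y| <= 1.
  exact: (scaled_norm_le (wXnC n) (lXCu n)).
have wEa n := half_system_scaled n gJ gR (lXu n) (lXCu n) (@EA n).
have wEb n := half_system_scaled n gG gR (lXCu n) (lXu n) (@EB n).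
have [P [vA [Pcvg LA hA wA sA]]] := half_limit FU gJ gR wXn wX XnXF lf rt t0 lwa lwb Cwa Cwb wEa.
have [Q [vB [Qcvg LB hB wB sB]]] := half_limit FU gG gR wXnC wXC XnXFC lf rt t0 lwb lwa Cwb Cwa wEb.
have lf1 : L1 f by exact: (Lp2_L1 mO Ooo lf).
have lvA : L1 vA by exact: (Lp2_L1 mO Ooo LA).
have lvB : L1 vB by exact: (Lp2_L1 mO Ooo LB).
have lfV V x : admissible_kernel V -> L1 (fun y => f y * V x y).
  move=> [cV _ _]; have := kernel_mul_L1 oO bO cV x lf1.
  by congr (integrable _ _ (EFin \o _)); apply/funext => y; rewrite mulrC.
have kE (V : T -> T -> R) w x : kint V w x = \int[mu]_(y in Omega) (w y * V x y).
  by apply: eq_Rintegral => y _; rewrite mulrC.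
have kcvg V (w : nat -> T -> R) v x : admissible_kernel V ->
    (forall phi, L1 phi -> L1 (fun x => f x * phi x) ->
       \int[mu]_(x in Omega) (w n x * phi x) @[n --> F] --> \int[mu]_(x in Omega) (v x * phi x)) ->
    kint V (w n) x @[n --> F] --> kint V v x.
  move=> gV wv; rewrite kE; under eq_cvg do rewrite kE.
  by apply: wv; [exact: kint_L1_fun|exact: lfV].
have PE x : P x = kint VJ vA x + kint VR vB x.
  have h : potential VJ VR wa wb n x @[n --> F] --> kint VJ vA x + kint VR vB x.
    by apply: cvgD; exact: kcvg.
  exact: (cvg_unique (@norm_hausdorff R R^o) (Pcvg x) h).
have QE x : Q x = kint VG vB x + kint VR vA x.
  have h : potential VG VR wb wa n x @[n --> F] --> kint VG vB x + kint VR vA x.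
    by apply: cvgD; exact: kcvg.
  exact: (cvg_unique (@norm_hausdorff R R^o) (Qcvg x) h).
have l1 := L1_cst mO 1 Ooo.
have lf11 : L1 (fun x => f x * 1) by under eq_fun do rewrite mulr1.
have AB0 : \int[mu]_(x in Omega) (vA x + vB x) = 0.
  have E (w : T -> R) : \int[mu]_(x in Omega) w x = \int[mu]_(x in Omega) (w x * 1).
    by apply: eq_Rintegral => x _; rewrite mulr1.
  have h1 : \int[mu]_(x in Omega) (wa n x * 1) + \int[mu]_(x in Omega) (wb n x * 1) @[n --> F]
       --> \int[mu]_(x in Omega) (vA x + vB x).
    rewrite (RintegralD mO lvA lvB) (E vA) (E vB).
    by apply: cvgD; [exact: (wA _ l1 lf11)|exact: (wB _ l1 lf11)].
  apply: (@cvg_unique _ (@norm_hausdorff R R^o) _ _ _ _ h1).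
  rewrite (_ : (fun n => _) = (fun=> 0)); first exact: cvg_cst.
  apply/funext => n; rewrite -!E -(RintegralD mO (lwa n) (lwb n)).
  rewrite -[RHS](mulr0 (r n)) -(u0 n) -(RintegralZl _ mO (lu n)).
  by apply: eq_Rintegral => x _; rewrite /wa /wb; ring.
have cAB : limit_pair VJ VG VR X (fun x => t * f x) vA vB.
  split => //; apply: filterE => x Ox.
    by rewrite hA// PE.
  by rewrite hB// QE.
(* If t = 0, the weak limits vanish by uniqueness, so P = Q = 0 and the scaled
   solutions tend to 0 in L^1, which contradicts rs. *)
have tn0 : t != 0.
  apply/eqP => tE.
  have l0 := L1_cst mO 0 Ooo.
  have k0 V x : admissible_kernel V -> kint V (fun=> 0) x = 0.
    move=> _; rewrite kE; under eq_Rintegral do rewrite mul0r.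
    by rewrite (Rintegral_cst mu mO) mul0r.
  have c0 : limit_pair VJ VG VR X (fun x => t * f x) (fun=> 0) (fun=> 0).
    have z0 := Lp2_cst mO 0 Ooo.
    split => //.
    - by under eq_Rintegral do rewrite addr0; rewrite (Rintegral_cst mu mO) mul0r.
    - by apply: filterE => x Ox; rewrite !k0// tE; ring.
    - by apply: filterE => x Ox; rewrite !k0// tE; ring.
  have vAB0 := limit_pair_unique wX cAB c0.
  have kA0 V x : admissible_kernel V -> kint V vA x = 0.
    move=> gV; rewrite -(k0 V x gV); have [cV _ _] := gV; apply: (Rintegral_ae_eq mO).
    - exact: (L1_measurable (kernel_mul_L1 oO bO cV x lvA)).
    - exact: (L1_measurable (kernel_mul_L1 oO bO cV x l0)).
    by apply: filterS vAB0 => y h Oy; have [-> _] := h Oy.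
  have kB0 V x : admissible_kernel V -> kint V vB x = 0.
    move=> gV; rewrite -(k0 V x gV); have [cV _ _] := gV; apply: (Rintegral_ae_eq mO).
    - exact: (L1_measurable (kernel_mul_L1 oO bO cV x lvB)).
    - exact: (L1_measurable (kernel_mul_L1 oO bO cV x l0)).
    by apply: filterS vAB0 => y h Oy; have [_ ->] := h Oy.
  have P0 x : P x = 0 by rewrite PE (kA0 _ _ gJ) (kB0 _ _ gR) addr0.
  have Q0 x : Q x = 0 by rewrite QE (kA0 _ _ gR) (kB0 _ _ gG) addr0.
  have d0 : 0 < 4^-1 :> R by rewrite invr_gt0.
  have /cvgrPdist_le /(_ _ d0) rsmall := rt.
  have [n [[/= na nb] nr]] := filter_ex (filterI (filterI (sA tE P0 _ d0) (sB tE Q0 _ d0)) rsmall).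
  have : r n * s n <= \int[mu]_(x in Omega) `|wa n x| + \int[mu]_(x in Omega) `|wb n x|.
    have nwa := integrable_norm (lwa n); have nwb := integrable_norm (lwb n).
    rewrite -(RintegralD mO nwa nwb) -(RintegralZl _ mO (integrable_norm (lu n))).
    apply: (le_Rintegral mO).
    - exact: (L1Z mO (r n) (integrable_norm (lu n))).
    - exact: (L1D mO nwa nwb).
    move=> x Ox; rewrite -[r n in leLHS](ger0_norm (ltW (r0 n))) -normrM.
    apply: le_trans (ler_normD _ _).
    by rewrite /wa /wb -mulrDr -mulrDl addrC subrK mul1r.
  move: na nb nr; rewrite rs tE sub0r normrN (ger0_norm (ltW (r0 n))).
  lra.
have tV : t^-1 * t = 1 by rewrite mulVf.
exists (fun x => t^-1 * vA x), (fun x => t^-1 * vB x); split.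
  have cst0 : measurable_fun Omega (fun=> t^-1 : R) by exact: measurable_cst.
  split.
  - exact: (Lp2M mO (M := `|t^-1|) cst0 _ LA).
  - exact: (Lp2M mO (M := `|t^-1|) cst0 _ LB).
  - rewrite -[RHS](mulr0 t^-1) -AB0 -(RintegralZl _ mO (L1D mO lvA lvB)).
    by apply: eq_Rintegral => x _; rewrite mulrDr.
  - apply: filterE => x Ox; rewrite (kintZ _ x gJ lvA) (kintZ _ x gR lvB).
    rewrite mulrCA hA// PE; rewrite -[in RHS](mul1r (f x)) -tV; ring.
  - apply: filterE => x Ox; rewrite (kintZ _ x gG lvB) (kintZ _ x gR lvA).
    rewrite mulrCA hB// QE; rewrite -[in RHS](mul1r (f x)) -tV; ring.
move=> phi lphi2.
have lphi : L1 phi by exact: (Lp2_L1 mO Ooo).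
have lfphi : L1 (fun x => f x * phi x) by exact: Lp2_mul_L1.
have rV : (r n)^-1 @[n --> F] --> t^-1 by apply: cvgV.
have unscale Y w v : (forall n, weight (Y n)) -> L1 (fun x => v x * phi x) ->
    (forall n x, w n x = r n * (Y n x * u n x)) ->
    \int[mu]_(x in Omega) (w n x * phi x) @[n --> F] --> \int[mu]_(x in Omega) (v x * phi x) ->
    \int[mu]_(x in Omega) (Y n x * u n x * phi x) @[n --> F] -->
      \int[mu]_(x in Omega) (t^-1 * v x * phi x).
  move=> wY lv wE wv.
  have -> : \int[mu]_(x in Omega) (t^-1 * v x * phi x) = t^-1 * \int[mu]_(x in Omega) (v x * phi x).
    by rewrite -(RintegralZl _ mO lv); apply: eq_Rintegral => x _; rewrite mulrA.
  have lY n : L1 (fun x => Y n x * u n x * phi x).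
    have := weightM_L1 oO (wY n) (Lp2_mul_L1 mO (lu2 n) lphi2).
    by congr (integrable _ _ (EFin \o _)); apply/funext => x; rewrite mulrA.
  rewrite (_ : (fun n => _) = fun n => (r n)^-1 * \int[mu]_(x in Omega) (w n x * phi x)).
    exact: cvgM.
  apply/funext => n.
  have -> : \int[mu]_(x in Omega) (w n x * phi x) =
      r n * \int[mu]_(x in Omega) (Y n x * u n x * phi x).
    by rewrite -(RintegralZl _ mO (lY n)); apply: eq_Rintegral => x _; rewrite wE mulrA.
  by rewrite mulKf// gt_eqF.
split.
- by apply: (unscale Xn wa vA) => //; [exact: Lp2_mul_L1|exact: wA].
- by apply: (unscale (fun n y => 1 - Xn n y) wb vB) => //; [exact: Lp2_mul_L1|exact: wB].
Qed.

(** Any ultrafilter provides the limits; uniqueness shows that they do not depend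
    on it, and then [cvg_ultra] applies. *)
Lemma weak_limit : exists uA uB, limit_pair VJ VG VR X f uA uB /\
    forall phi, Lp 2%:E Omega phi ->
     (\int[mu]_(x in Omega) ((Xn n x * u n x) * phi x) @[n --> \oo] -->
       \int[mu]_(x in Omega) (uA x * phi x)) /\
     (\int[mu]_(x in Omega) (((1 - Xn n x) * u n x) * phi x) @[n --> \oo] -->
       \int[mu]_(x in Omega) (uB x * phi x)).
Proof.
have [F [FU oF]] := ultraFilterLemma (eventually_filter : ProperFilter \oo).
have [uA [uB [lAB _]]] := ultra_limit FU oF.
exists uA, uB; split => // phi lphi.
have same G : UltraFilter G -> \oo `<=` G -> exists vA vB,
    [/\ \int[mu]_(x in Omega) (vA x * phi x) = \int[mu]_(x in Omega) (uA x * phi x),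
        \int[mu]_(x in Omega) (vB x * phi x) = \int[mu]_(x in Omega) (uB x * phi x) ,
     (\int[mu]_(x in Omega) ((Xn n x * u n x) * phi x) @[n --> G] -->
       \int[mu]_(x in Omega) (vA x * phi x)) &
     (\int[mu]_(x in Omega) (((1 - Xn n x) * u n x) * phi x) @[n --> G] -->
       \int[mu]_(x in Omega) (vB x * phi x))].
  move=> GU oG; have [vA [vB [lvAB cvg]]] := ultra_limit GU oG.
  have E := limit_pair_unique wX lvAB lAB.
  have [[lA lB _ _ _] [l'A l'B _ _ _]] := (lAB, lvAB).
  exists vA, vB; have [cA cB] := cvg _ lphi; split => //.
  - apply: (Rintegral_ae_eq mO).
    + exact: (L1_measurable (Lp2_mul_L1 mO l'A lphi)).
    + exact: (L1_measurable (Lp2_mul_L1 mO lA lphi)).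
    by apply: filterS E => x h Ox; have [-> _] := h Ox.
  - apply: (Rintegral_ae_eq mO).
    + exact: (L1_measurable (Lp2_mul_L1 mO l'B lphi)).
    + exact: (L1_measurable (Lp2_mul_L1 mO lB lphi)).
    by apply: filterS E => x h Ox; have [_ ->] := h Ox.
split; apply: cvg_ultra => G GU oG; have [vA [vB [EA' EB' cA cB]]] := same G GU oG.
- by rewrite -EA'.
- by rewrite -EB'.
Qed.

End two_phases.
End domain.

(** * From the equations of the theorem to half systems *)

Section reduction.
Context (R : realType) (N : nat) (Omega : set (Rn R N)).
Notation T := (Rn R N).
Hypotheses (oO : open Omega) (bO : bounded_set Omega).
Notation mu := (@lebesgue R N).
Local Notation L1 f := (mu.-integrable Omega (EFin \o f)).
Local Notation kint := (kernel_integral Omega).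
Local Notation den := (denominator Omega).
Local Notation weight := (weight Omega).

Let mO : measurable Omega. Proof. exact: open_measurable_Rn. Qed.
Let Ooo : (mu Omega < +oo)%E. Proof. exact: bounded_lebesgue_lty. Qed.

Lemma weak_L2_limit_unique (w : nat -> T -> R) (u v : T -> R) :
  Lp 2%:E Omega u -> Lp 2%:E Omega v ->
  weak_L2_cvg Omega w u -> weak_L2_cvg Omega w v -> ae_equal Omega u v.
Proof.
move=> lu lv wu wv.
have ld : Lp 2%:E Omega (fun x => u x + (-1) * v x).
  apply: (Lp2D mO lu); apply: (Lp2M mO (M := 1) _ _ lv); first exact: measurable_cst.
  by move=> x _; rewrite normrN1.
have E := cvg_unique (@norm_hausdorff R R^o) (wu _ ld) (wv _ ld).
have ldd := Lp2_mul_L1 mO ld ld.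
suff : {ae mu, forall x, Omega x -> (u x + (-1) * v x) * (u x + (-1) * v x) = 0}.
  apply: filterS => x h Ox; have /eqP := h Ox.
  by rewrite mulf_eq0 orbb mulN1r subr_eq0 => /eqP.
apply: (Rintegral_eq0_ae mO ldd) => [x _|]; first by rewrite -expr2 sqr_ge0.
have l1 := Lp2_mul_L1 mO lu ld; have l2 := Lp2_mul_L1 mO lv ld.
transitivity (\int[mu]_(x in Omega) (u x * (u x + (-1) * v x) - v x * (u x + (-1) * v x))).
  by apply: eq_Rintegral => x _; ring.
by rewrite (RintegralB mO l1 l2) E subrr.
Qed.

(** Testing with the negative part of Y, which is bounded, gives minus the
    integral of its square, which is therefore 0. *)
Lemma weak_limit_ge0 (Yn : nat -> T -> R) (Y : T -> R) (M : R) :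
  (forall n x, Omega x -> 0 <= Yn n x) ->
  measurable_fun Omega Y -> (forall x, Omega x -> `|Y x| <= M) ->
  (forall phi, L1 phi -> \int[mu]_(x in Omega) (Yn n x * phi x) @[n --> \oo] -->
     \int[mu]_(x in Omega) (Y x * phi x)) ->
  {ae mu, forall x, Omega x -> 0 <= Y x}.
Proof.
move=> Yn0 mY YM YnY.
pose phi x := maxr 0 (- Y x).
have mphi : measurable_fun Omega phi.
  by apply: measurable_maxr; [exact: measurable_cst|exact: measurableT_comp].
have phiM x : Omega x -> `|phi x| <= M.
  move=> Ox; apply: le_trans (YM x Ox).
  by rewrite /phi; case: (leP 0 (- Y x)) => ?; rewrite ?normrN ?normr0.
have lphi : L1 phi.
  have := L1M mO mphi phiM (L1_cst mO 1 Ooo).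
  by congr (integrable _ _ (EFin \o _)); apply/funext => x; rewrite mulr1.
have lphi2 : L1 (fun x => phi x * phi x) by exact: (L1M mO mphi phiM lphi).
have E : \int[mu]_(x in Omega) (Y x * phi x) = - \int[mu]_(x in Omega) (phi x * phi x).
  rewrite -mulN1r -(RintegralZl _ mO lphi2); apply: eq_Rintegral => x _.
  rewrite /phi; case: (leP 0 (- Y x)) => ?; ring.
have pos : 0 <= \int[mu]_(x in Omega) (Y x * phi x).
  have near0 : \forall n \near \oo, 0 <= \int[mu]_(x in Omega) (Yn n x * phi x).
    apply: nearW => n; apply: Rintegral_ge0 => x Ox.
    by rewrite mulr_ge0 ?Yn0// /phi le_max lexx.
  exact: (@closed_cvg _ _ _ _ _ (fun x : R => 0 <= x) (@closed_ge R 0) near0 _ (YnY _ lphi)).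
have : {ae mu, forall x, Omega x -> phi x * phi x = 0}.
  apply: (Rintegral_eq0_ae mO lphi2) => [x _|]; first by rewrite -expr2 sqr_ge0.
  apply/eqP; rewrite eq_le -oppr_ge0 -E pos/=; apply: Rintegral_ge0 => x _.
  by rewrite -expr2 sqr_ge0.
apply: filterS => x h Ox; have /eqP := h Ox.
rewrite mulf_eq0 orbb /phi => /eqP; case: (leP 0 (- Y x)) => ? ?; lra.
Qed.

Lemma Lp_infty_ae_bounded (X : T -> R) : lebesgue [set: T] != 0%E ->
  Lp +oo%E Omega X -> measurable_fun Omega X /\
    exists M : R, {ae mu, forall x, Omega x -> `|X x| <= M}.
Proof.
move=> T0; rewrite /Lp/= inE => /andP[]; rewrite !inE/= => mX; split.
  exact/(measurable_restrictT _ mO).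
move: b; rewrite /finite_norm unlock.
have -> : (0 < mu [set: T])%E by rewrite lt0e T0 measure_ge0.
move=> Xoo.
have [M hM] : exists M : R, (ess_sup mu (abse \o (EFin \o patch (fun=> 0%R) Omega X)) <= M%:E)%E.
  move: Xoo; case: (ess_sup _ _) => [s _| |_]//; first by exists s.
  by exists 0; exact: leNye.
exists M; move/ess_supP: hM; apply: filterS => x /= + Ox.
by rewrite patchE mem_set// lee_fin.
Qed.

(** X lies in [0, 1] almost everywhere only; clipping gives a representative for
    which this holds everywhere. X is first truncated to be bounded everywhere,
    so that [weak_limit_ge0] applies to it and to 1 - X. *)
Lemma weak_star_weight (A : nat -> set T) (X : T -> R) :
  lebesgue [set: T] != 0%E -> (forall n, measurable (A n)) ->
  Lp +oo%E Omega X -> weak_star_Loo_cvg Omega (fun n x => \1_(A n) x) X ->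
  exists X' : T -> R, [/\ weight X', measurable_fun Omega X, ae_equal Omega X X' &
    forall phi, L1 phi -> \int[mu]_(x in Omega) (\1_(A n) x * phi x) @[n --> \oo] -->
     \int[mu]_(x in Omega) (X' x * phi x)].
Proof.
move=> T0 mA LX AX; have [mX [M XM]] := Lp_infty_ae_bounded T0 LX.
have mA1 n : measurable_fun Omega (\1_(A n) : T -> R) by exact: measurable_indic.
pose clip a b r : R := maxr a (minr b r).
have mclip a b Y : measurable_fun Omega Y -> measurable_fun Omega (fun x => clip a b (Y x)).
  move=> mY; apply: measurable_maxr; first exact: measurable_cst.
  by apply: measurable_minr => //; exact: measurable_cst.
have clipE a b r : a <= r -> r <= b -> clip a b r = r.
  by move=> ar rb; rewrite /clip min_r// max_r.
have transfer Y : measurable_fun Omega Y -> ae_equal Omega X Y -> forall phi, L1 phi ->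
    \int[mu]_(x in Omega) (\1_(A n) x * phi x) @[n --> \oo] --> \int[mu]_(x in Omega) (Y x * phi x).
  move=> mY XY phi lphi; have mphi := L1_measurable lphi.
  rewrite -(_ : \int[mu]_(x in Omega) (X x * phi x) = \int[mu]_(x in Omega) (Y x * phi x)).
    exact/AX/Lp1P.
  apply: (Rintegral_ae_eq mO); [exact: measurable_funM|exact: measurable_funM|].
  by apply: filterS XY => x h Ox; rewrite h.
pose X0 x := clip (- `|M|) `|M| (X x).
have mX0 : measurable_fun Omega X0 by exact: mclip.
have X0E : ae_equal Omega X X0.
  apply: filterS XM => x h Ox; have := le_trans (h Ox) (ler_norm M).
  by rewrite ler_norml => /andP[? ?]; rewrite /X0 clipE.
have X0M x : `|X0 x| <= `|M|.
  rewrite /X0 /clip ler_norml le_max lexx/= ge_max ge_min lexx/= andbT.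
  by have := normr_ge0 M; lra.
have indic01 n x : 0 <= (\1_(A n) x : R) <= 1.
  by rewrite indicE; case: (_ \in _); rewrite ?lexx ?ler01.
have ge0 : {ae mu, forall x, Omega x -> 0 <= X0 x}.
  apply: (@weak_limit_ge0 (fun n => \1_(A n)) X0 `|M| _ mX0 (fun x _ => X0M x)).
  - by move=> n x _; have /andP[? ?] := indic01 n x.
  - exact: transfer.
have le1 : {ae mu, forall x, Omega x -> 0 <= 1 - X0 x}.
  apply: (@weak_limit_ge0 (fun n x => 1 - \1_(A n) x) (fun x => 1 - X0 x) (1 + `|M|)).
  - by move=> n x _; have /andP[_ ?] := indic01 n x; rewrite subr_ge0.
  - by apply: measurable_funB => //; exact: measurable_cst.
  - by move=> x _; rewrite (le_trans (ler_normB _ _))// normr1 lerD2l.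
  move=> phi lphi.
  have E (Y : T -> R) (B : R) : measurable_fun Omega Y -> (forall x, Omega x -> `|Y x| <= B) ->
      \int[mu]_(x in Omega) ((1 - Y x) * phi x) =
      \int[mu]_(x in Omega) phi x - \int[mu]_(x in Omega) (Y x * phi x).
    move=> mY YB; rewrite -(RintegralB mO lphi (L1M mO mY YB lphi)).
    by apply: eq_Rintegral => x _; ring.
  rewrite (E X0 `|M|)//.
  have E1 n : \int[mu]_(x in Omega) ((1 - \1_(A n) x) * phi x) =
      \int[mu]_(x in Omega) phi x - \int[mu]_(x in Omega) (\1_(A n) x * phi x).
    by apply: (E (\1_(A n)) 1) => // x _; have /andP[? ?] := indic01 n x; rewrite ger0_norm.
  under eq_cvg do rewrite E1.
  by apply: cvgB; [exact: cvg_cst|exact: transfer].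
pose X' x := clip 0 1 (X x).
have XX' : ae_equal Omega X X'.
  apply: filterS3 X0E ge0 le1 => x h1 h2 h3 Ox.
  by rewrite /X' clipE// (h1 Ox) ?h2// -subr_ge0 h3.
have mX' : measurable_fun Omega X' by exact: mclip.
exists X'; split => //; last exact: transfer.
split => // x _; rewrite /X' /clip le_max lexx/= ge_max ler01 ge_min lexx//.
Qed.

Lemma cross_integral V (v Y Y' F : T -> R) (a b : R) x : admissible_kernel V ->
  L1 v -> L1 Y' -> measurable_fun Omega Y -> ae_equal Omega Y Y' ->
  (forall y, F y = V x y * (a * v y - Y y * b)) ->
  \int[mu]_(y in Omega) F y = a * kint V v x - b * kint V Y' x.
Proof.
move=> [cV _ _] lv lY' mY YY' FE.
have kv := kernel_mul_L1 oO bO cV x lv.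
have kY := kernel_mul_L1 oO bO cV x lY'.
rewrite /kernel_integral -(RintegralZl _ mO kv) -(RintegralZl _ mO kY).
rewrite -(RintegralB mO (L1Z mO a kv) (L1Z mO b kY)).
have mV : measurable_fun Omega (V x) by exact/continuous_measurable_Rn/kernel_continuous.
apply: (Rintegral_ae_eq mO).
- apply: (@eq_measurable_fun _ _ _ _ _ (fun y => V x y * (a * v y - Y y * b))).
    by move=> y _; rewrite FE.
  apply: (measurable_funM mV); apply: measurable_funB.
    exact: (L1_measurable (L1Z mO a lv)).
  exact: (measurable_funM mY (measurable_cst _)).
- exact: (L1_measurable (L1B mO (L1Z mO a kv) (L1Z mO b kY))).
by apply: filterS YY' => y h Oy; rewrite FE (h Oy); ring.
Qed.

Section systems.
Variables (VJ VG VR : T -> T -> R).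
Hypotheses (gJ : admissible_kernel VJ) (gG : admissible_kernel VG) (gR : admissible_kernel VR).

(** Expanding the four integrals, the terms in uA x and uB x collect into the
    denominators; X may be replaced by X' under the integral signs and at almost
    every x. *)
Lemma limit_systemE X X' f vA vB : L1 vA -> L1 vB -> weight X' ->
  measurable_fun Omega X -> ae_equal Omega X X' ->
  limit_system VJ VG VR Omega X f vA vB <->
  half_system Omega VJ VR X' f vA vB /\
  half_system Omega VG VR (fun y => 1 - X' y) f vB vA.
Proof.
move=> lA lB wX' mX XX'.
have lX' := weight_L1 oO bO wX'.
have lX'C := weight_L1 oO bO (weightC wX').
have mXC : measurable_fun Omega (fun y => 1 - X y).
  by apply: measurable_funB => //; exact: measurable_cst.
have XXC : ae_equal Omega (fun y => 1 - X y) (fun y => 1 - X' y).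
  by apply: filterS XX' => y h Oy; rewrite h.
have E1 x := @cross_integral VJ vA X X' _ (X x) (vA x) x gJ lA lX' mX XX' (fun=> erefl).
have E2 x : \int[mu]_(y in Omega) (VR x y * (X x * vB y - vA x * (1 - X y))) =
    X x * kint VR vB x - vA x * kint VR (fun y => 1 - X' y) x.
  by apply: (cross_integral gR lB lX'C mXC XXC) => y; ring.
have E3 x : \int[mu]_(y in Omega) (VR x y * (vA y * (1 - X x) - vB x * X y)) =
    (1 - X x) * kint VR vA x - vB x * kint VR X' x.
  by apply: (cross_integral gR lA lX' mX XX') => y; ring.
have E4 x : \int[mu]_(y in Omega) (VG x y * (vB y * (1 - X x) - vB x * (1 - X y))) =
    (1 - X x) * kint VG vB x - vB x * kint VG (fun y => 1 - X' y) x.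
  by apply: (cross_integral gG lB lX'C mXC XXC) => y; ring.
have CC : (fun y => 1 - (1 - X' y)) = X' by apply/funext => y; ring.
split=> -[h1 h2]; split.
- move: h1 XX'; apply: filterS2 => x h e Ox; move: (h Ox) (e Ox).
  by rewrite E1 E2 /denominator => {}h <-; lra.
- move: h2 XX'; apply: filterS2 => x h e Ox; move: (h Ox) (e Ox).
  by rewrite E3 E4 /denominator CC => {}h <-; lra.
- move: h1 XX'; apply: filterS2 => x h e Ox; move: (h Ox) (e Ox).
  by rewrite E1 E2 /denominator => {}h ->; lra.
- move: h2 XX'; apply: filterS2 => x h e Ox; move: (h Ox) (e Ox).
  by rewrite E3 E4 /denominator CC => {}h ->; lra.
Qed.

Lemma indic_complement (A B : set T) x : Omega = A `|` B -> A `&` B = set0 ->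
  Omega x -> \1_B x = 1 - \1_A x :> R.
Proof.
move=> OAB AB0 Ox; rewrite !indicE.
have [Ax|nAx] := pselect (A x).
  rewrite (mem_set Ax) memNset ?subrr// => Bx.
  by have : set0 x by rewrite -AB0.
rewrite (memNset nAx) mem_set ?subr0//.
by move: Ox; rewrite OAB => -[].
Qed.

Lemma integral_part V (C : set T) (u : T -> R) x : admissible_kernel V ->
  measurable C -> C `<=` Omega -> L1 u ->
  \int[mu]_(y in C) (V x y * (u y - u x)) =
  kint V (fun y => \1_C y * u y) x - u x * kint V (\1_C) x.
Proof.
move=> [cV _ _] mC CO lu.
have wC : weight \1_C by exact: weight_indic.
have l1 := kernel_mul_L1 oO bO cV x (weightM_L1 oO wC lu).
have l2 := kernel_mul_L1 oO bO cV x (weight_L1 oO bO wC).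
rewrite /kernel_integral -(RintegralZl _ mO l2) -(RintegralB mO l1 (L1Z mO (u x) l2)).
rewrite -{1}(setIidr CO) Rintegral_mkcondr; apply: eq_Rintegral => y _.
rewrite patchE indicE; case: (y \in C) => /=; first by ring.
by rewrite mul0r !mulr0 subr0.
Qed.

(** On A the equation is the first half system; outside A both sides of it are
    0. *)
Lemma neumann_half_systems (A B : set T) f u : measurable A -> measurable B ->
  Omega = A `|` B -> A `&` B = set0 -> L1 u ->
  neumann_solution VJ VG VR Omega A B f u ->
  half_system Omega VJ VR (\1_A) f (fun y => \1_A y * u y) (fun y => (1 - \1_A y) * u y) /\
  half_system Omega VG VR (fun y => 1 - \1_A y) f
    (fun y => (1 - \1_A y) * u y) (fun y => \1_A y * u y).
Proof.
move=> mA mB OAB AB0 lu sol.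
have AO : A `<=` Omega by rewrite OAB; exact: subsetUl.
have BO : B `<=` Omega by rewrite OAB; exact: subsetUr.
have BE y : Omega y -> \1_B y = 1 - \1_A y :> R by exact: indic_complement.
have kB V x : kint V (\1_B) x = kint V (fun y => 1 - \1_A y) x.
  by apply: eq_Rintegral => y /[!inE] Oy; rewrite BE.
have kBu V x : kint V (fun y => \1_B y * u y) x = kint V (fun y => (1 - \1_A y) * u y) x.
  by apply: eq_Rintegral => y /[!inE] Oy; rewrite BE.
have CC : (fun y => 1 - (1 - \1_A y : R)) = \1_A by apply/funext => y; ring.
split; apply: filterS sol => x h Ox; move: (h Ox).
  rewrite !integral_part// !kB !kBu (BE x Ox) /denominator indicE.
  by case: (_ \in _) => /= ->; ring.
rewrite !integral_part// !kB !kBu (BE x Ox) /denominator CC indicE.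
by case: (_ \in _) => /= ->; ring.
Qed.

End systems.
End reduction.

Lemma kernel_axioms_admissible (R : realType) (N : nat) (V : Rn R N -> Rn R N -> R) :
  kernel_axioms V -> admissible_kernel V.
Proof. by case. Qed.

(** V 0 has integral 1, which is impossible if the whole space is null. *)
Lemma kernel_axioms_lebesgue_neq0 (R : realType) (N : nat) (V : Rn R N -> Rn R N -> R) :
  kernel_axioms V -> lebesgue [set: Rn R N] != 0%E.
Proof.
move=> [cV _ _ _ V1]; apply/eqP => T0; have := V1 0.
rewrite null_set_integral//; first by move/eqP; rewrite eq_sym onee_eq0.
exact/measurable_EFinP/continuous_measurable_Rn/kernel_continuous.
Qed.

Unset Implicit Arguments.

Theorem theorem2p1 (R : realType) (N : nat) (Omega : set (Rn R N))
    (VJ VG VR : Rn R N -> Rn R N -> R)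
    (A B : nat -> set (Rn R N)) (X : Rn R N -> R)
    (f : Rn R N -> R) (u : nat -> Rn R N -> R) :
  bounded_domain Omega ->
  kernel_axioms VJ -> kernel_axioms VG -> kernel_axioms VR ->
  (forall n, [/\ measurable (A n), measurable (B n),
                 Omega = A n `|` B n & A n `&` B n = set0]) ->
  Lp +oo%E Omega X ->
  W Omega f ->
  (forall n, W Omega (u n) /\
             neumann_solution VJ VG VR Omega (A n) (B n) f (u n)) ->
  weak_star_Loo_cvg Omega (fun n x => \1_(A n) x) X ->
  exists uA uB : Rn R N -> R,
    unique_ae_pair Omega
      (fun vA vB =>
         [/\ zero_mean_pair Omega vA vB,
             weak_L2_cvg Omega (fun n x => \1_(A n) x * u n x) vA &
             weak_L2_cvg Omega (fun n x => \1_(B n) x * u n x) vB])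
      uA uB /\
    unique_ae_pair Omega
      (fun vA vB =>
         zero_mean_pair Omega vA vB /\ limit_system VJ VG VR Omega X f vA vB)
      uA uB.
Proof.
move=> [neO oO cO bO] kJ kG kR AB LX [lf _] sol AX.
have [[gJ gG] gR] := (kernel_axioms_admissible kJ, kernel_axioms_admissible kG, kernel_axioms_admissible kR).
have T0 := kernel_axioms_lebesgue_neq0 kJ.
have open_null (U : set (Rn R N)) : open U -> lebesgue U = 0%E -> U = set0.
  exact: open_lebesgue_eq0.
have mO := open_measurable_Rn oO.
have Ooo := bounded_lebesgue_lty bO.
have mA n : measurable (A n) by have [] := AB n.
have [X' [wX' mX XX' AX']] := weak_star_weight oO bO T0 mA LX AX.
have lu2 n : Lp 2%:E Omega (u n) by have [[]] := sol n.
have u0 n : \int[lebesgue]_(x in Omega) u n x = 0 by have [[]] := sol n.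
have wA n : weight Omega \1_(A n) by exact: weight_indic.
have halves n := neumann_half_systems oO bO gJ gG gR (mA n) (let: And4 _ mB _ _ := AB n in mB)
  (let: And4 _ _ E _ := AB n in E) (let: And4 _ _ _ E := AB n in E)
  (Lp2_L1 mO Ooo (lu2 n)) (sol n).2.
have [uA [uB [lAB wAB]]] := weak_limit oO bO neO cO open_null gJ gG gR wA wX' AX' lf lu2 u0
  (fun n => (halves n).1) (fun n => (halves n).2).
have [lA lB AB0 hA hB] := lAB.
have zAB : zero_mean_pair Omega uA uB by [].
have systemE vA vB : Lp 2%:E Omega vA -> Lp 2%:E Omega vB -> _ :=
  fun lvA lvB => limit_systemE oO bO gJ gG gR f (Lp2_L1 mO Ooo lvA) (Lp2_L1 mO Ooo lvB)
    wX' mX XX'.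
have wuA : weak_L2_cvg Omega (fun n x => \1_(A n) x * u n x) uA.
  by move=> phi lphi; have [] := wAB phi lphi.
have wuB : weak_L2_cvg Omega (fun n x => \1_(B n) x * u n x) uB.
  move=> phi lphi; have [_] := wAB phi lphi.
  rewrite (_ : (fun n => \int[lebesgue]_(x in Omega) (\1_(B n) x * u n x * phi x)) =
    fun n => \int[lebesgue]_(x in Omega) ((1 - \1_(A n) x) * u n x * phi x))//.
  apply/funext => n; apply: eq_Rintegral => x /[!inE] Ox.
  by have [_ _ OAB dAB] := AB n; rewrite (indic_complement OAB dAB Ox).
exists uA, uB; split; split => //.
- move=> vA vB [[lvA lvB _] wvA wvB]; split.
    exact: (weak_L2_limit_unique oO lvA lA wvA wuA).
  exact: (weak_L2_limit_unique oO lvB lB wvB wuB).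
- by split => //; apply/systemE.
- move=> vA vB [[lvA lvB vAB0] /(systemE _ _ lvA lvB)[hvA hvB]].
  have E : {ae lebesgue, forall x, Omega x -> vA x = uA x /\ vB x = uB x}.
    by apply: (limit_pair_unique oO bO neO cO open_null gJ gG gR wX' _ lAB).
  by split; apply: filterS E => x h Ox; have [] := h Ox.
Qed.
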